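(* Let $X\sim N(\mu,\Sigma)$ be a normally distributed random variable in $\mathbb{R}^3$ with mean $\mu\in\mathbb{R}^3$, $\mu\neq0$, and covariance matrix $\Sigma$. If $\Sigma=\sigma^2I_3$ with $\sigma>0$, then the intrinsic mean of $\mathrm{pr}(X)=X/\|X\|$ on $\mathbb{S}^2$ is $$\mathbb{E}[\mathrm{pr}(X)]=\mathrm{pr}(\mu)=\frac{\mu}{\|\mu\|}.$$
   Context: $\mathbb{S}^2\subset\mathbb{R}^3$ is the unit sphere with the induced Riemannian metric, geodesic distance $\operatorname{dist}$ and volume form $\mathrm{dVol}$; $\mathrm{pr}(x)=x/\|x\|$ for $x\ne0$. For an absolutely continuous $\mathbb{S}^2$-valued random variable $Y$ with density $p_Y$ with respect to $\mathrm{dVol}$, the intrinsic (Fréchet) mean is $$\mathbb{E}[Y]=\operatorname*{arginf}_{q\in\mathbb{S}^2}\int_{\mathbb{S}^2}\operatorname{dist}(q,y)^2p_Y(y)\,\mathrm{dVol}(y).$$ *)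

(* Defs.v *)
From HB Require Import structures.
From mathcomp Require Import all_boot all_order all_algebra.
From mathcomp Require Import all_classical all_reals all_analysis.
From mathcomp Require Import measurable_realfun ring.

Set Implicit Arguments.
Unset Strict Implicit.
Unset Printing Implicit Defensive.

Import Order.TTheory GRing.Theory Num.Theory.
Import numFieldNormedType.Exports.

Local Open Scope classical_set_scope.
Local Open Scope ring_scope.

(* Row vectors carry the product sigma-algebra, i.e. the one generated by the
   coordinates, as [n.-tuple R] does in the library; for [n] finite it is the
   Borel sigma-algebra of R^n. *)
Section measurable_rV.
Context {R : realType} {n : nat}.

Let coord (i : 'I_n) (x : 'rV[R]_n) : measurableTypeR R := x ord0 i.

Let rV_set0 : g_sigma_preimage coord set0.
Proof. exact: sigma_algebra0. Qed.

Let rV_setC A : g_sigma_preimage coord A -> g_sigma_preimage coord (~` A).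
Proof. exact: sigma_algebraC. Qed.

Let rV_bigcup (F : (set 'rV[R]_n)^nat) :
  (forall i, g_sigma_preimage coord (F i)) ->
  g_sigma_preimage coord (\bigcup_i (F i)).
Proof. exact: sigma_algebra_bigcup. Qed.

HB.instance Definition _ := @isMeasurable.Build
  (measure_tuple_display default_measure_display)
  'rV[R]_n (g_sigma_preimage coord) rV_set0 rV_setC rV_bigcup.

Lemma measurable_coord (i : 'I_n) :
  measurable_fun [set: 'rV[R]_n] (fun x : 'rV[R]_n => x ord0 i).
Proof.
move=> _ Y mY; rewrite setTI; apply: sub_sigma_algebra => /=.
rewrite -bigcup_seq/=; exists i => /=; first by rewrite mem_index_enum.
by exists Y => //; rewrite setTI.
Qed.

Lemma measurable_fun_rVP d (T : measurableType d) (f : T -> 'rV[R]_n) :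
  measurable_fun [set: T] f <->
  forall i, measurable_fun [set: T] (fun x => f x ord0 i).
Proof.
split=> [mf i|mf].
  exact: (measurableT_comp (measurable_coord i) mf).
move=> _ A mA; rewrite setTI.
suff : <<s \big[setU/set0]_(i < n) preimage_set_system setT (coord i) measurable >>
    `<=` [set A | measurable (f @^-1` A)] by exact.
apply: smallest_sub.
  split=> /=.
  - by rewrite preimage_set0; exact: measurable0.
  - by move=> B mB; rewrite setTD preimage_setC; exact: measurableC.
  - by move=> F mF; rewrite preimage_bigcup; exact: bigcupT_measurable.
rewrite -bigcup_seq; apply: bigcup_sub => i _ B [C mC <-] /=.
by rewrite setTI -comp_preimage -[X in measurable X]setTI; exact: mf.
Qed.
End measurable_rV.

Section euclidean.
Context {R : realType}.

Definition dotmul n (x y : 'rV[R]_n) : R := (x *m y^T) ord0 ord0.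

(* the norm [`|x|] of the library on ['rV_n] is the sup norm *)
Definition enorm n (x : 'rV[R]_n) : R := Num.sqrt (dotmul x x).

(* [pr 0 = 0] is a junk value, outside of the sphere *)
Definition pr n (x : 'rV[R]_n) : 'rV[R]_n := (enorm x)^-1 *: x.

Definition vec3 (a b c : R) : 'rV[R]_3 := \row_i [:: a; b; c]`_i.

Lemma dotmulE n (x y : 'rV[R]_n) : dotmul x y = \sum_i x ord0 i * y ord0 i.
Proof. by rewrite /dotmul mxE; apply: eq_bigr => i _; rewrite mxE. Qed.

Lemma measurable_enorm n : measurable_fun [set: 'rV[R]_n] (@enorm n).
Proof.
have mdot : measurable_fun [set: 'rV[R]_n] (fun x => dotmul x x).
  under eq_fun do rewrite dotmulE.
  by apply: measurable_sum => i; apply: measurable_funM; exact: measurable_coord.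
have msqrt : measurable_fun [set: R] (@Num.sqrt R).
  exact: (continuous_measurable_fun (@sqrt_continuous R)).
exact: (measurableT_comp msqrt mdot).
Qed.

Lemma enorm_ge0 n (x : 'rV[R]_n) : 0 <= enorm x.
Proof. exact: sqrtr_ge0. Qed.

Lemma measurable_pr n : measurable_fun [set: 'rV[R]_n] (@pr n).
Proof.
apply/measurable_fun_rVP => i.
under eq_fun do rewrite mxE -powR_inv1 ?enorm_ge0//.
apply: measurable_funM; last exact: measurable_coord.
have := measurableT_comp (@measurable_powR R (-1)) (@measurable_enorm n).
exact.
Qed.

HB.instance Definition _ n :=
  isMeasurableFun.Build _ _ _ _ (@pr n) (@measurable_pr n).

Lemma measurable_vec3 d (T : measurableType d) (f g h : T -> R) :
  measurable_fun setT f -> measurable_fun setT g -> measurable_fun setT h ->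
  measurable_fun setT (fun t => vec3 (f t) (g t) (h t)).
Proof.
move=> mf mg mh; apply/measurable_fun_rVP => i.
by under eq_fun do rewrite mxE; case: i => -[|[|[|]]].
Qed.

End euclidean.

Section normal_law.
Context {R : realType}.
Local Notation leb := (@lebesgue_measure R).

Definition lebesgue_measure3 : set 'rV[R]_3 -> \bar R :=
  pushforward ((leb \x leb) \x leb)%E (fun u => vec3 u.1.1 u.1.2 u.2).

Lemma measurable_vec3_uncurry :
  measurable_fun [set: (R * R * R)%type] (fun u => vec3 u.1.1 u.1.2 u.2).
Proof. by apply: measurable_vec3 => //; exact: measurableT_comp. Qed.

HB.instance Definition _ := Measure.copy lebesgue_measure3
  (measure_function_pushforward__canonical__measure_function_Measure
     ((leb \x leb) \x leb)%E measurable_vec3_uncurry).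

Definition mvnormal_pdf3 (mu : 'rV[R]_3) (Sigma : 'M[R]_3) (x : 'rV[R]_3) : R :=
  (Num.sqrt ((2 * pi) ^+ 3 * \det Sigma))^-1 *
  expR (- (1 / 2) * ((x - mu) *m invmx Sigma *m (x - mu)^T) ord0 ord0).

(* X ~ N(mu, Sigma) in R^3, for a nondegenerate covariance matrix *)
Definition is_normal3 d (T : measurableType d) (P : probability T R)
    (X : {RV P >-> 'rV[R]_3}) (mu : 'rV[R]_3) (Sigma : 'M[R]_3) : Prop :=
  [/\ Sigma^T = Sigma,
      forall v : 'rV[R]_3, v != 0 -> 0 < (v *m Sigma *m v^T) ord0 ord0 &
      forall A : set 'rV[R]_3, measurable A ->
        distribution P X A =
          (\int[lebesgue_measure3]_(x in A) (mvnormal_pdf3 mu Sigma x)%:E)%E].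

End normal_law.

Section sphere.
Context {R : realType}.
Local Notation leb := (@lebesgue_measure R).

Definition S2 : set 'rV[R]_3 := [set x | enorm x = 1].

(* The geodesic distance is the infimum of the lengths, for the metric induced
   by R^3, of the C^1 curves of the sphere joining two points.  Outside of
   [0, 1], [gamma] need not stay on the sphere: it only serves to make the
   derivatives at the endpoints two-sided, at no loss of generality since a C^1
   curve on [0, 1] extends affinely. *)
Definition sphere_curve (x y : 'rV[R]_3) (gamma : R -> 'rV[R]_3) : Prop :=
  [/\ gamma 0 = x, gamma 1 = y,
      forall t, t \in `[0, 1] -> S2 (gamma t) /\ derivable gamma t 1 &
      {within `[0, 1], continuous (derive1 gamma)}].

Definition curve_length (gamma : R -> 'rV[R]_3) : R :=
  \int[leb]_(t in `[0, 1]) enorm (derive1 gamma t).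

Definition geodist (x y : 'rV[R]_3) : R :=
  inf [set curve_length gamma | gamma in sphere_curve x y].

(* The volume form is sqrt(det g) dtheta dphi, where g is the matrix of the
   induced metric in spherical coordinates; [sph_dom] parametrizes the sphere,
   bijectively up to the two poles. *)
Definition sph_coord (u : R * R) : 'rV[R]_3 :=
  vec3 (sin u.1 * cos u.2) (sin u.1 * sin u.2) (cos u.1).

Definition sph_dom : set (R * R) := `[0, pi] `*` `[0, 2 * pi[.

Definition sph_tangent (u : R * R) (i : 'I_2) : 'rV[R]_3 :=
  if i == 0 then derive1 (fun t => sph_coord (t, u.2)) u.1
  else derive1 (fun t => sph_coord (u.1, t)) u.2.

Definition sph_metric (u : R * R) : 'M[R]_2 :=
  \matrix_(i, j) dotmul (sph_tangent u i) (sph_tangent u j).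

Definition sph_area (u : R * R) : R := Num.sqrt (\det (sph_metric u)).

Definition dVol (A : set 'rV[R]_3) : \bar R :=
  (\int[leb \x leb]_(u in sph_dom `&` sph_coord @^-1` A) (sph_area u)%:E)%E.

Lemma sph_tangent0 u : sph_tangent u 0 =
  vec3 (cos u.1 * cos u.2) (cos u.1 * sin u.2) (- sin u.1).
Proof.
have D (i : 'I_3) : is_derive u.1 1 (fun t => sph_coord (t, u.2) ord0 i)
    (vec3 (cos u.1 * cos u.2) (cos u.1 * sin u.2) (- sin u.1) ord0 i).
  rewrite mxE; under eq_fun do rewrite mxE.
  case: i => -[|[|[|//]]] ? /=.
  - under eq_fun do rewrite mulrC.
    by rewrite mulrC; exact: (is_deriveZ (cos u.2) (is_derive_sin u.1)).
  - under eq_fun do rewrite mulrC.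
    by rewrite mulrC; exact: (is_deriveZ (sin u.2) (is_derive_sin u.1)).
  - exact: is_derive_cos.
rewrite /sph_tangent eqxx derive1E derive_mx.
  by apply/rowP => i; rewrite mxE (@derive_val _ _ _ _ _ _ _ (D i)).
by apply/derivable_mxP => i j; rewrite ord1; have [] := D j.
Qed.

Lemma sph_tangent1 u : sph_tangent u 1 =
  vec3 (- (sin u.1 * sin u.2)) (sin u.1 * cos u.2) 0.
Proof.
have D (i : 'I_3) : is_derive u.2 1 (fun t => sph_coord (u.1, t) ord0 i)
    (vec3 (- (sin u.1 * sin u.2)) (sin u.1 * cos u.2) 0 ord0 i).
  rewrite mxE; under eq_fun do rewrite mxE.
  case: i => -[|[|[|//]]] ? /=.
  - rewrite -mulrN.
    exact: (is_deriveZ (sin u.1) (is_derive_cos u.2)).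
  - exact: (is_deriveZ (sin u.1) (is_derive_sin u.2)).
  - exact: is_derive_cst.
have -> : sph_tangent u 1 = derive1 (fun t => sph_coord (u.1, t)) u.2 by [].
rewrite derive1E derive_mx.
  by apply/rowP => i; rewrite mxE (@derive_val _ _ _ _ _ _ _ (D i)).
by apply/derivable_mxP => i j; rewrite ord1; have [] := D j.
Qed.

Lemma sph_areaE u : sph_area u = `|sin u.1|.
Proof.
have g00 : dotmul (sph_tangent u 0) (sph_tangent u 0) = 1.
  rewrite dotmulE !big_ord_recl big_ord0 sph_tangent0 !mxE/=.
  transitivity (cos u.1 ^+ 2 * (cos u.2 ^+ 2 + sin u.2 ^+ 2) + sin u.1 ^+ 2).
    by ring.
  by rewrite cos2Dsin2 mulr1 cos2Dsin2.
have g01 : dotmul (sph_tangent u 0) (sph_tangent u 1) = 0.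
  rewrite dotmulE !big_ord_recl big_ord0 sph_tangent0 sph_tangent1 !mxE/=.
  by ring.
have g11 : dotmul (sph_tangent u 1) (sph_tangent u 1) =
    sin u.1 ^+ 2.
  rewrite dotmulE !big_ord_recl big_ord0 sph_tangent1 !mxE/=.
  transitivity (sin u.1 ^+ 2 * (cos u.2 ^+ 2 + sin u.2 ^+ 2)); first by ring.
  by rewrite cos2Dsin2 mulr1.
rewrite /sph_area (_ : \det _ = sin u.1 ^+ 2) ?sqrtr_sqr//.
rewrite (expand_det_row _ ord0) !big_ord_recl big_ord0 /cofactor !det_mx11.
rewrite (_ : lift ord0 ord0 = 1 :> 'I_2); last exact/val_inj.
rewrite !mxE (_ : lift ord0 0 = 1 :> 'I_2); last exact/val_inj.
by rewrite g00 g01 g11 mul0r !addr0 mul1r expr0 mul1r.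
Qed.

Lemma measurable_sph_coord : measurable_fun [set: R * R] sph_coord.
Proof.
have ms : measurable_fun [set: R] (@sin R).
  exact: (continuous_measurable_fun (@continuous_sin R)).
have mc : measurable_fun [set: R] (@cos R).
  exact: (continuous_measurable_fun (@continuous_cos R)).
by apply: measurable_vec3; try apply: measurable_funM; exact: measurableT_comp.
Qed.

Lemma measurable_sph_area : measurable_fun [set: R * R] sph_area.
Proof.
rewrite (_ : sph_area = fun u => `|sin u.1|); last first.
  by apply/funext => u; exact: sph_areaE.
apply: measurableT_comp => //; apply: measurableT_comp => //.
exact: (continuous_measurable_fun (@continuous_sin R)).
Qed.

Lemma measurable_sph_dom : measurable sph_dom.
Proof. exact: measurableX. Qed.

Let dVol0 : dVol set0 = 0%E.
Proof. by rewrite /dVol preimage_set0 setI0 integral_set0. Qed.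

Let dVol_ge0 A : (0 <= dVol A)%E.
Proof. by apply: integral_ge0 => u _; rewrite lee_fin sqrtr_ge0. Qed.

Let dVol_sigma_additive : semi_sigma_additive dVol.
Proof.
move=> F mF tF mUF; rewrite /dVol preimage_bigcup setI_bigcupr.
rewrite ge0_integral_bigcup/=.
- by apply: is_cvg_ereal_nneg_natsum_cond => // n _ _; exact: dVol_ge0.
- move=> k; apply: measurableI; first exact: measurable_sph_dom.
  by rewrite -[X in measurable X]setTI; exact: measurable_sph_coord.
- apply/measurable_EFinP/measurable_funTS; exact: measurable_sph_area.
- by move=> u _; rewrite lee_fin sqrtr_ge0.
- apply/trivIsetP => i j _ _ ij; rewrite setIACA setIid -preimage_setI.
  by move/trivIsetP : tF => ->//; rewrite preimage_set0 setI0.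
Qed.

HB.instance Definition _ :=
  isMeasure.Build _ _ _ dVol dVol0 dVol_ge0 dVol_sigma_additive.

End sphere.

Section intrinsic_mean.
Context {R : realType}.

(* [p] is a density of [Y] with respect to dVol; taking [A = S2] shows that
   [Y] is almost surely on the sphere. *)
Definition is_density d (T : measurableType d) (P : probability T R)
    (Y : {RV P >-> 'rV[R]_3}) (p : 'rV[R]_3 -> R) : Prop :=
  [/\ measurable_fun S2 p, forall y, S2 y -> 0 <= p y &
      forall A : set 'rV[R]_3, measurable A ->
        distribution P Y A = (\int[dVol]_(y in A `&` S2) (p y)%:E)%E].

Definition frechet_fun (p : 'rV[R]_3 -> R) (q : 'rV[R]_3) : \bar R :=
  (\int[dVol]_(y in S2) (geodist q y ^+ 2 * p y)%:E)%E.

Definition arginf_S2 (F : 'rV[R]_3 -> \bar R) : set 'rV[R]_3 :=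
  [set q | S2 q /\ forall q', S2 q' -> (F q <= F q')%E].

(* The intrinsic mean is only defined for an absolutely continuous [Y]; the
   functional does not depend on the choice of the density. *)
Definition is_intrinsic_mean d (T : measurableType d) (P : probability T R)
    (Y : {RV P >-> 'rV[R]_3}) (m : 'rV[R]_3) : Prop :=
  (exists p, is_density Y p) /\
  (forall p, is_density Y p -> arginf_S2 (frechet_fun p) = [set m]).

End intrinsic_mean.

(* Main.v *)
Require Import Defs.
From HB Require Import structures.
From mathcomp Require Import all_boot all_order all_algebra.
From mathcomp Require Import all_classical all_reals all_analysis.
From mathcomp Require Import measurable_realfun ring lra.

Set Implicit Arguments.
Unset Strict Implicit.
Unset Printing Implicit Defensive.

Import Order.TTheory GRing.Theory Num.Theory.
Import numFieldNormedType.Exports.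

Local Open Scope classical_set_scope.
Local Open Scope ring_scope.

(** For an isotropic normal vector X, the density of X is a decreasing function
    of the distance to mu, and the squared geodesic distance on the sphere is an
    increasing function of the angle.  The Fréchet functional of [pr X] at a
    point q of the sphere is therefore an integral over R^3,
      F(q) = int acos(<q, pr x>)^2 phi(x) dx     ([frechet_fun_normal]),
    and q can be compared with m = pr mu by symmetry.  If q differs from m, let
    r be the orthogonal reflection that exchanges them, and a(x) the squared
    angle between m and pr x, so that a(r x) is the squared angle between q and
    pr x.  Since r preserves Lebesgue measure,
      2 F(q) - 2 F(m) = int (a(r x) - a(x)) (phi(x) - phi(r x)) dx.
    On the side of the mirror that contains m, x is closer than r x to mu and
    makes a smaller angle with m, so that both factors are positive; on the
    other side both are negative.  The integrand is thus positive outside of the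
    mirror, and F(m) < F(q) ([sqr_angle_integral_lt]).

    Three facts support this computation.

    - The geodesic distance, an infimum of lengths of curves, is the angle
      ([geodistE]): great circles realize the angle, and conversely the angle
      from a fixed point cannot grow faster than arc length
      ([acos_le_curve_length]).

    - Reflections preserve Lebesgue measure ([volume_factor_reflection]): they
      are products of maps that change one coordinate by a linear form, for which
      the change of variable is Tonelli's theorem and an affine substitution on
      the line.

    - The law of [pr X] has a density with respect to the area of the sphere
      ([normal_pr_is_density]).  By the Radon-Nikodym theorem this only requires
      that the cone over a set of zero area be Lebesgue negligible
      ([dVol0_leb3_pr]), which follows from one-dimensional arguments on each
      meridian, where the cotangent of the polar angle is a coordinate on the
      vertical line. *)

(** * Affine substitutions on the line *)

Lemma measurable_affine (R : realType) (a b : R) :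
  measurable_fun [set: measurableTypeR R]
    (fun t : measurableTypeR R => a * t + b : measurableTypeR R).
Proof. by apply: measurable_funD => //; apply: measurable_funM. Qed.

(** Both sides are measures in [A], so it is enough to compare them on half-open
    intervals. *)
Lemma lebesgue_measure_affine (R : realType) (a b : R) (A : set R) :
  a != 0 -> measurable A ->
  lebesgue_measure A =
  (`|a|%:E * lebesgue_measure ((fun t : R => a * t + b)%R @^-1` A))%E.
Proof.
move=> a0 mA.
have mf := measurable_affine a b.
pose nu := mscale (NngNum (normr_ge0 a))
  (measure_function_pushforward__canonical__measure_function_Measure
     (@lebesgue_measure R) mf).
rewrite (@lebesgue_measure_unique R nu)// => _ [[x y] _ <-] /=.
rewrite /nu /mscale/= /pushforward.
have [xy|yx] := ltP x y; last first.
  rewrite set_itv_ge ?bnd_simp -?leNgt//.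
  by rewrite preimage_set0 !measure0 mule0.
move: a0; rewrite neq_lt => /orP[a0|a0].
  rewrite (_ : _ @^-1` _ = `[(y - b) / a, (x - b) / a[%classic); last first.
    apply/seteqP; split => t /=; rewrite !in_itv/= => /andP[h1 h2].
      rewrite ler_ndivrMr// ltr_ndivlMr//; apply/andP; split; lra.
    move: h1 h2; rewrite ler_ndivrMr// ltr_ndivlMr// => h1 h2.
    apply/andP; split; lra.
  rewrite !lebesgue_measure_itv/= !lte_fin xy.
  rewrite ltr_ndivrMr// mulfVK ?lt_eqF// ltrD2r xy -EFinD -EFinM ltr0_norm//.
  by congr EFin; field; rewrite lt_eqF.
rewrite (_ : _ @^-1` _ = `](x - b) / a, (y - b) / a]%classic); last first.
  apply/seteqP; split => t /=; rewrite !in_itv/= => /andP[h1 h2].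
    rewrite ler_pdivlMr// ltr_pdivrMr//; apply/andP; split; lra.
  move: h1 h2; rewrite ler_pdivlMr// ltr_pdivrMr// => h1 h2.
  apply/andP; split; lra.
rewrite !lebesgue_measure_itv/= !lte_fin xy.
rewrite ltr_pdivrMr// mulfVK ?gt_eqF// ltrD2r xy -EFinD -EFinM gtr0_norm//.
by congr EFin; field; rewrite gt_eqF.
Qed.

Lemma ge0_integral_affine (R : realType) (a b : R) (f : R -> \bar R) :
  a != 0 -> measurable_fun setT f -> (forall t, 0 <= f t)%E ->
  (\int[lebesgue_measure]_t f t =
   `|a|%:E * \int[lebesgue_measure]_t f (a * t + b)%R)%E.
Proof.
move=> a0 mf f0.
have mg := measurable_affine a b.
pose mu := measure_function_pushforward__canonical__measure_function_Measure
     (@lebesgue_measure R) mg.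
pose nu := mscale (NngNum (normr_ge0 a)) mu.
rewrite (@eq_measure_integral _ _ _ _ nu); last first.
  by move=> A mA _; rewrite /nu/= /mscale/= [LHS](lebesgue_measure_affine b a0 mA).
rewrite ge0_integral_mscale//=; congr (_ * _)%E.
by rewrite (ge0_integral_pushforward mg)//= => y _; exact: f0.
Qed.

(** * Orders of integration in R^3 *)

Section leb3.
Context (R : realType).
Local Notation mR := (measurableTypeR R).
Local Notation leb := (@lebesgue_measure R).

Lemma measurable_vec3_prod :
  measurable_fun [set: mR * mR * mR]
    (fun u : mR * mR * mR => vec3 u.1.1 u.1.2 u.2).
Proof. exact: measurable_vec3_uncurry. Qed.

(** Tonelli's theorem asks for sigma-finite factors, and the plane is one of them
    when R^3 is cut into planes and lines; squares centered at 0 exhaust it. *)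
Let leb2_sigma_finite : sigma_finite [set: mR * mR] (leb \x leb)%E.
Proof.
exists (fun n => `[- n%:R, n%:R] `*` `[- n%:R, n%:R]) => [|n]; last first.
  split; first exact: measurableX.
  rewrite product_measure1E//= lebesgue_measure_itv/=.
  by case: ifPn => _; rewrite ?mule0// -EFinD -EFinM ltry.
apply/esym; rewrite -subTset => -[x y] _.
exists (Num.truncn (`|x| + `|y|)).+1 => //.
have h : `|x| + `|y| <= (Num.truncn (`|x| + `|y|)).+1%:R.
  exact/ltW/truncnS_gt.
split; rewrite /= in_itv/= -ler_norml; apply: le_trans h;
  by rewrite ?lerDl ?lerDr.
Qed.

Let leb2_mixin := Measure_isSigmaFinite.Build _ _ _ (leb \x leb)%E leb2_sigma_finite.
Let leb2 : {sigma_finite_measure set (mR * mR)%type -> \bar R} :=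
  HB.pack (leb \x leb)%E leb2_mixin.

Section tonelli.
Variable f : 'rV[R]_3 -> \bar R.
Hypotheses (mf : measurable_fun setT f) (f0 : forall x, (0 <= f x)%E).

Let mF : measurable_fun [set: mR * mR * mR] (fun u => f (vec3 u.1.1 u.1.2 u.2)).
Proof. exact: (measurableT_comp mf measurable_vec3_prod). Qed.

Let leb3_prod : (\int[lebesgue_measure3]_v f v =
   \int[(leb \x leb) \x leb]_u f (vec3 u.1.1 u.1.2 u.2))%E.
Proof.
have f0' : {in [set: 'rV[R]_3], forall y, 0 <= f y}%E by move=> ? _; exact: f0.
exact: (ge0_integral_pushforward measurable_vec3_prod
  ((leb \x leb) \x leb)%E measurableT mf f0').
Qed.

Let leb3_pair : (\int[lebesgue_measure3]_v f v =
   \int[leb \x leb]_u \int[leb]_z f (vec3 u.1 u.2 z))%E.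
Proof.
rewrite leb3_prod.
have F0 u : (0 <= f (vec3 u.1.1 u.1.2 u.2))%E by exact: f0.
exact: (@fubini_tonelli1 _ _ (mR * mR)%type mR R leb2 leb _ mF F0).
Qed.

Lemma measurable_leb3_fibre :
  measurable_fun [set: mR * mR] (fun u => \int[leb]_z f (vec3 u.1 u.2 z))%E.
Proof.
have F0 u : (0 <= f (vec3 u.1.1 u.1.2 u.2))%E by exact: f0.
exact: (@measurable_fun_fubini_tonelli_F _ _ (mR * mR)%type mR R leb _ mF F0).
Qed.

(** In the iterated integrals below, each coordinate comes innermost at least
    once, which is what transvections require; the order with [y] outermost
    serves to slice cones. *)
Lemma leb3_xyz : (\int[lebesgue_measure3]_v f v =
   \int[leb]_x \int[leb]_y \int[leb]_z f (vec3 x y z))%E.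
Proof.
rewrite leb3_pair; apply: (fubini_tonelli1 _ measurable_leb3_fibre) => u.
by apply: integral_ge0 => ? _; exact: f0.
Qed.

Lemma leb3_yxz : (\int[lebesgue_measure3]_v f v =
   \int[leb]_y \int[leb]_x \int[leb]_z f (vec3 x y z))%E.
Proof.
rewrite leb3_pair; apply: (fubini_tonelli2 _ measurable_leb3_fibre) => u.
by apply: integral_ge0 => ? _; exact: f0.
Qed.

Lemma leb3_xzy : (\int[lebesgue_measure3]_v f v =
   \int[leb]_x \int[leb]_z \int[leb]_y f (vec3 x y z))%E.
Proof.
rewrite leb3_xyz; apply: eq_integral => x _.
have mFx : measurable_fun [set: mR * mR] (fun u => f (vec3 x u.1 u.2)).
  by apply: (measurableT_comp mf); apply: measurable_vec3.
exact: (fubini_tonelli _ mFx).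
Qed.

Lemma leb3_zyx : (\int[lebesgue_measure3]_v f v =
   \int[leb]_z \int[leb]_y \int[leb]_x f (vec3 x y z))%E.
Proof.
rewrite leb3_prod.
have F0 u : (0 <= f (vec3 u.1.1 u.1.2 u.2))%E by exact: f0.
have h2 := @fubini_tonelli2 _ _ (mR * mR)%type mR R leb2 leb _ mF F0.
rewrite [LHS]h2; apply: eq_integral => z _.
have mFz : measurable_fun [set: mR * mR] (fun u => f (vec3 u.1 u.2 z)).
  by apply: (measurableT_comp mf); apply: measurable_vec3.
exact: (fubini_tonelli2 _ mFz).
Qed.

End tonelli.
End leb3.

(** * The dot product, transvections and reflections *)

Section linear_algebra.
Context {R : realType} {n : nat}.
Implicit Types v w x y : 'rV[R]_n.

Lemma dotmulC x y : dotmul x y = dotmul y x.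
Proof. by rewrite !dotmulE; apply: eq_bigr => i _; rewrite mulrC. Qed.

Lemma dotmulDr v x y : dotmul v (x + y) = dotmul v x + dotmul v y.
Proof. by rewrite /dotmul raddfD/= mulmxDr mxE. Qed.

Lemma dotmulZr v a x : dotmul v (a *: x) = a * dotmul v x.
Proof. by rewrite /dotmul linearZ/= -scalemxAr mxE. Qed.

Lemma dotmulDl v x y : dotmul (x + y) v = dotmul x v + dotmul y v.
Proof. by rewrite ![dotmul _ v]dotmulC dotmulDr. Qed.

Lemma dotmulZl v a x : dotmul (a *: x) v = a * dotmul x v.
Proof. by rewrite ![dotmul _ v]dotmulC dotmulZr. Qed.

Lemma dotmulNr v x : dotmul v (- x) = - dotmul v x.
Proof. by rewrite -scaleN1r dotmulZr mulN1r. Qed.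

Lemma dotmulNl v x : dotmul (- x) v = - dotmul x v.
Proof. by rewrite -scaleN1r dotmulZl mulN1r. Qed.

Lemma dotmul0l v : dotmul 0 v = 0.
Proof. by rewrite -(scale0r v) dotmulZl mul0r. Qed.

Lemma dotmul0r v : dotmul v 0 = 0.
Proof. by rewrite dotmulC dotmul0l. Qed.

Lemma dotmul_delta v k : dotmul v (delta_mx 0 k) = v ord0 k.
Proof. by rewrite /dotmul trmx_delta -colE mxE. Qed.

Lemma dotmul_deltal v k : dotmul (delta_mx 0 k) v = v ord0 k.
Proof. by rewrite dotmulC dotmul_delta. Qed.

Lemma dotmul_ge0 x : 0 <= dotmul x x.
Proof. by rewrite dotmulE sumr_ge0// => i _; rewrite -expr2 sqr_ge0. Qed.

Lemma dotmul_eq0 x : (dotmul x x == 0) = (x == 0).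
Proof.
apply/idP/eqP => [|->]; last first.
  by rewrite dotmul0l.
rewrite dotmulE psumr_eq0 => [/allP h|i _]; last by rewrite -expr2 sqr_ge0.
apply/rowP => i; rewrite mxE; apply/eqP.
by rewrite -sqrf_eq0 expr2; apply: h; rewrite mem_index_enum.
Qed.

Lemma row_neq0_coord x : x != 0 -> exists k, x ord0 k != 0.
Proof.
move=> x0; apply/existsP; apply: contraNT x0 => /existsPn x0.
by apply/eqP/rowP => i; rewrite mxE; apply/eqP; have := x0 i; rewrite negbK.
Qed.

Lemma measurable_dotmul v : measurable_fun [set: 'rV[R]_n] (dotmul v).
Proof.
rewrite (_ : dotmul v = fun x => \sum_i v ord0 i * x ord0 i); last first.
  by apply/funext => x; rewrite dotmulE.
by apply: measurable_sum => i; apply: measurable_funM => //; exact: measurable_coord.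
Qed.

(** Only coordinate [k] changes, and it changes by a linear form: on each line
    parallel to the [k]-th axis this is an affine map. *)
Definition transvect (k : 'I_n) v x := x + dotmul v x *: delta_mx 0 k.

Lemma measurable_transvect k v :
  measurable_fun [set: 'rV[R]_n] (transvect k v).
Proof.
apply/measurable_fun_rVP => i; under eq_fun do rewrite !mxE.
apply: measurable_funD; first exact: measurable_coord.
by apply: measurable_funM => //; exact: measurable_dotmul.
Qed.

Definition reflection w x := x - (2 * dotmul w x / dotmul w w) *: w.

End linear_algebra.

Section vec3.
Context {R : realType}.
Implicit Types x y : 'rV[R]_3.

Lemma ord3P (k : 'I_3) : [\/ k = 0, k = 1 | k = 2].
Proof.
by case: k => [[|[|[|//]]]] k3;
  [apply: Or31|apply: Or32|apply: Or33]; exact/val_inj.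
Qed.

Lemma row3_ext x y : x ord0 0 = y ord0 0 -> x ord0 1 = y ord0 1 ->
  x ord0 2 = y ord0 2 -> x = y.
Proof.
move=> h0 h1 h2; apply/rowP => -[[|[|[|//]]] i3].
- by rewrite (_ : Ordinal _ = 0)//; exact/val_inj.
- by rewrite (_ : Ordinal _ = 1)//; exact/val_inj.
- by rewrite (_ : Ordinal _ = 2)//; exact/val_inj.
Qed.

Lemma dotmul3E x y : dotmul x y =
  x ord0 0 * y ord0 0 + x ord0 1 * y ord0 1 + x ord0 2 * y ord0 2.
Proof.
rewrite dotmulE !big_ord_recl big_ord0 addr0 addrA.
rewrite (_ : lift ord0 ord0 = 1 :> 'I_3); last exact/val_inj.
by rewrite (_ : lift ord0 (lift ord0 ord0) = 2 :> 'I_3); last exact/val_inj.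
Qed.

End vec3.

Section leb3_linear.
Context (R : realType).
Local Notation mR := (measurableTypeR R).
Local Notation leb := (@lebesgue_measure R).
Implicit Types (f : 'rV[R]_3 -> \bar R) (v w x : 'rV[R]_3).

(** With coordinate [k] innermost, the transvection is
    t |-> (1 + v_k) t + b where b depends on the other coordinates only. *)
Lemma leb3_transvect (k : 'I_3) v f :
  measurable_fun setT f -> (forall x, 0 <= f x)%E -> 1 + v ord0 k != 0 ->
  (\int[lebesgue_measure3]_x f x =
   `|1 + v ord0 k|%:E * \int[lebesgue_measure3]_x f (transvect k v x))%E.
Proof.
move=> mf f0 vk0; have mfE := measurableT_comp mf (measurable_transvect k v).
rewrite -ge0_integralZl_EFin//=.
have mg : measurable_fun [set: 'rV[R]_3]
    (fun x => `|1 + v ord0 k|%:E * f (transvect k v x))%E.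
  exact: measurable_funeM.
have g0 x : (0 <= `|1 + v ord0 k|%:E * f (transvect k v x))%E.
  by rewrite mule_ge0.
(* [h] will run along a line parallel to the k-th axis *)
have key (h : R -> 'rV[R]_3) : measurable_fun [set: mR] h ->
    (exists b, forall t : R, transvect k v (h t) = h ((1 + v ord0 k) * t + b)) ->
  (\int[leb]_t f (h t) =
   \int[leb]_t (`|1 + v ord0 k|%:E * f (transvect k v (h t))))%E.
  move=> mh [b hb].
  rewrite ge0_integralZl_EFin//=; last exact: (measurableT_comp mfE mh).
  rewrite (@ge0_integral_affine _ _ b _ vk0)//; last exact: measurableT_comp.
  by congr (_ * _)%E; apply: eq_integral => t _; rewrite hb.
have [kE|kE|kE] := ord3P k; rewrite {k}kE in vk0 mfE mg g0 key *.
- rewrite (leb3_zyx mf f0) (leb3_zyx mg g0).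
  apply: eq_integral => z _; apply: eq_integral => y _.
  apply: (key (fun a => vec3 a y z)); first exact: measurable_vec3.
  exists (v ord0 1 * y + v ord0 2 * z) => x.
  by rewrite /transvect dotmul3E; apply: row3_ext; rewrite !mxE/=; ring.
- rewrite (leb3_xzy mf f0) (leb3_xzy mg g0).
  apply: eq_integral => x _; apply: eq_integral => z _.
  apply: (key (fun a => vec3 x a z)); first exact: measurable_vec3.
  exists (v ord0 0 * x + v ord0 2 * z) => y.
  by rewrite /transvect dotmul3E; apply: row3_ext; rewrite !mxE/=; ring.
- rewrite (leb3_xyz mf f0) (leb3_xyz mg g0).
  apply: eq_integral => x _; apply: eq_integral => y _.
  apply: (key (fun a => vec3 x y a)); first exact: measurable_vec3.
  exists (v ord0 0 * x + v ord0 1 * y) => z.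
  by rewrite /transvect dotmul3E; apply: row3_ext; rewrite !mxE/=; ring.
Qed.

(** For a linear [T], [c] is the absolute value of its determinant.  Stating the
    change of variable for all integrands makes factors multiply under
    composition. *)
Definition volume_factor (c : R) (T : 'rV[R]_3 -> 'rV[R]_3) :=
  measurable_fun setT T /\
  forall f, measurable_fun setT f -> (forall x, 0 <= f x)%E ->
    (\int[lebesgue_measure3]_x f x =
     c%:E * \int[lebesgue_measure3]_x f (T x))%E.

Lemma volume_factor_comp (a b : R) S T :
  volume_factor a S -> volume_factor b T -> volume_factor (a * b) (S \o T).
Proof.
move=> [mS hS] [mT hT]; split=> [|f mf f0]; first exact: measurableT_comp.
rewrite hS// (hT (f \o S))//.
- by rewrite muleA -EFinM.
- exact: measurableT_comp.
- by move=> x; exact: f0.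
Qed.

Lemma volume_factor_transvect (k : 'I_3) v : 1 + v ord0 k != 0 ->
  volume_factor `|1 + v ord0 k| (transvect k v).
Proof.
move=> vk0; split=> [|f mf f0]; first exact: measurable_transvect.
exact: leb3_transvect.
Qed.

(** A reflection is conjugate, by the shear that turns [dotmul w x] into a
    coordinate, to a map that negates this coordinate and shears the others.  All
    these maps are transvections, and their factors multiply to 1. *)
Lemma volume_factor_reflection w : w != 0 -> volume_factor 1 (reflection w).
Proof.
move=> w0.
have [k wk0] := row_neq0_coord w0.
pose e (i : 'I_3) : 'rV[R]_3 := delta_mx 0 i.
have ee (i j : 'I_3) : e i ord0 j = (j == i)%:R by rewrite mxE eqxx.
(* [U] makes [dotmul w x] the k-th coordinate, [U'] undoes it, and [V] is the
   reflection in the new coordinates; [transvect k (c k)] is the identity. *)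
pose a (i : 'I_3) := if i == k then 0 else - 2 * w ord0 i / dotmul w w.
pose c i := a i *: e k.
have cE i : 1 + c i ord0 i = 1.
  rewrite /c mxE ee /a; case: eqVneq => [_|_]; first by rewrite mul0r addr0.
  by rewrite mulr0 addr0.
pose U := transvect k (w - e k).
pose U' := transvect k ((w ord0 k)^-1 *: (e k - w)).
pose V x := transvect k (- 2 *: e k)
  (transvect 0 (c 0) (transvect 1 (c 1) (transvect 2 (c 2) x))).
have ww0 : dotmul w w != 0 by rewrite dotmul_eq0.
have UK x : U' (U x) = x.
  rewrite /U' /U /transvect dotmulZl !dotmulDl !dotmulNl !dotmulDr !dotmulZr.
  rewrite !dotmul_deltal !dotmul_delta !mxE !eqxx/= -addrA -scalerDl.
  by rewrite [X in X *: _](_ : _ = 0) ?scale0r ?addr0//; field.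
have VU x : V (U x) = U (reflection w x).
  set p := dotmul w x.
  have tE i b y : transvect i (b *: e k) y = y + (b * y ord0 k) *: e i.
    by rewrite /transvect dotmulZl dotmul_deltal.
  have Uk : U x ord0 k = p.
    rewrite /U /transvect dotmulDl dotmulNl dotmul_deltal !mxE !eqxx/= mulr1.
    by rewrite addrC subrK.
  have tkE i y : transvect i (c i) y = y + (a i * y ord0 k) *: e i by rewrite tE.
  have tk i y : transvect i (c i) y ord0 k = y ord0 k.
    rewrite tkE !mxE eqxx/= /a eq_sym.
    by case: eqVneq => _; rewrite ?mul0r ?mul0r ?mulr0 addr0.
  apply/rowP => i.
  rewrite /V [transvect k _ _]tE.
  rewrite (tk 0) (tk 1) (tk 2) (tkE 0) (tk 1) (tk 2) (tkE 1) (tk 2) (tkE 2) Uk.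
  have pr : dotmul w (reflection w x) = - p.
    by rewrite /reflection dotmulDr dotmulNr dotmulZr -/p; field.
  rewrite /U /transvect !dotmulDl !dotmulNl pr !dotmul_deltal -/p !mxE eqxx/= -/p.
  have -> : x 0 i + (p - x ord0 k) * (i == k)%:R + a 2 * p * (i == 2)%:R +
      a 1 * p * (i == 1)%:R + a 0 * p * (i == 0)%:R + - 2 * p * (i == k)%:R =
      x 0 i + (p - x ord0 k) * (i == k)%:R + a i * p + - 2 * p * (i == k)%:R.
    by have [->|->|->] := ord3P i; rewrite !eqxx/=; ring.
  rewrite /a (_ : 0 = ord0 :> 'I_1); last exact/val_inj.
  by case: eqVneq => [->|_] /=; field.
have factor_c i : volume_factor 1 (transvect i (c i)).
  have := @volume_factor_transvect i (c i).
  by rewrite cE normr1; apply; rewrite oner_neq0.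
have factor_k : volume_factor 1 (transvect k (- 2 *: e k)).
  have k1 : 1 + (- 2 *: e k) ord0 k = - 1 by rewrite !mxE !eqxx/=; ring.
  have := @volume_factor_transvect k (- 2 *: e k).
  by rewrite k1 normrN1; apply; rewrite oppr_eq0 oner_eq0.
have factor_U : volume_factor `|w ord0 k| U.
  have wkE : 1 + (w - e k) ord0 k = w ord0 k.
    by rewrite !mxE !eqxx/=; ring.
  by have := @volume_factor_transvect k (w - e k); rewrite wkE; apply.
have factor_U' : volume_factor `|(w ord0 k)^-1| U'.
  have wkE : 1 + ((w ord0 k)^-1 *: (e k - w)) ord0 k = (w ord0 k)^-1.
    by rewrite !mxE !eqxx/=; field.
  have := @volume_factor_transvect k ((w ord0 k)^-1 *: (e k - w)).
  by rewrite wkE; apply; rewrite invr_eq0.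
have := volume_factor_comp factor_U' (volume_factor_comp factor_k
  (volume_factor_comp (factor_c 0) (volume_factor_comp (factor_c 1)
  (volume_factor_comp (factor_c 2) factor_U)))).
rewrite !mul1r -normrM mulVf// normr1.
congr (volume_factor _ _); apply/funext => x /=.
by rewrite -[RHS]UK -VU.
Qed.

End leb3_linear.

(** * Integration against a density *)

Section integral_density.
Context d (T : measurableType d) (R : realType).
Variables (mu nu : {measure set T -> \bar R}) (p : T -> \bar R).
Hypotheses (mp : measurable_fun setT p) (p0 : forall x, (0 <= p x)%E).
Hypothesis pfin : forall x, p x \is a fin_num.
Hypothesis nuE : forall A, measurable A -> (nu A = \int[mu]_(x in A) p x)%E.

Import HBNNSimple.

Let integral_density_nnsfun (h : {nnsfun T >-> R}) :
  (\int[nu]_x (h x)%:E = \int[mu]_x ((h x)%:E * p x))%E.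
Proof.
under eq_integral do rewrite fimfunE -fsumEFin//.
rewrite ge0_integral_fsum//=; last 2 first.
- by move=> r; apply/measurable_EFinP; exact: measurableT_comp.
- by move=> r x _; exact: nnfun_muleindic_ge0.
transitivity (\int[mu]_x (\sum_(r \in range h)
    ((r * \1_(h @^-1` [set r]) x)%:E * p x)))%E; last first.
  apply: eq_integral => x _; rewrite -ge0_mule_fsuml.
    by rewrite fsumEFin// -fimfunE.
  by move=> r; exact: nnfun_muleindic_ge0.
rewrite ge0_integral_fsum//=; last 2 first.
- move=> r; apply: emeasurable_funM => //.
  by apply/measurable_EFinP; exact: measurableT_comp.
- by move=> r x _; rewrite mule_ge0//; exact: nnfun_muleindic_ge0.
apply: eq_fsbigr => r /[!inE] -[t _ hr].
under eq_integral do rewrite EFinM.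
rewrite integralZl_indic_nnsfun// integral_indic// setIT nuE//.
under [RHS]eq_integral do rewrite EFinM -muleA.
rewrite ge0_integralZl_EFin//=.
- congr (_ * _)%E; rewrite integral_mkcond; apply: eq_integral => x _.
  by rewrite epatch_indic muleC.
- by move=> x _; rewrite mule_ge0// lee_fin.
- by apply: emeasurable_funM => //; apply/measurable_EFinP.
- by rewrite -hr.
Qed.

(** The hypothesis is the case of indicators; simple functions follow by
    linearity, and all nonnegative functions by monotone convergence. *)
Lemma ge0_integral_density (g : T -> \bar R) :
  measurable_fun setT g -> (forall x, 0 <= g x)%E ->
  (\int[nu]_x g x = \int[mu]_x (g x * p x))%E.
Proof.
move=> mg g0; pose h := nnsfun_approx measurableT mg.
have gE x : g x = limn (fun n => (h n x)%:E).
  by apply/esym/cvg_lim => //; exact: cvg_nnsfun_approx.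
have hnd x : nondecreasing_seq (fun n => h n x).
  by move=> a b ab; exact/lefP/nd_nnsfun_approx.
transitivity (limn (fun n => \int[nu]_x (h n x)%:E))%E.
  rewrite -monotone_convergence//.
  - by apply: eq_integral => x _.
  - by move=> n; exact/measurable_EFinP.
  - by move=> n x _; rewrite lee_fin.
  - by move=> x _ a b ab; rewrite lee_fin; exact: hnd.
under eq_fun do rewrite integral_density_nnsfun.
rewrite -monotone_convergence//.
- apply: eq_integral => x _; apply/cvg_lim => //; apply: cvgeZr => //.
  exact: cvg_nnsfun_approx.
- by move=> n; apply: emeasurable_funM => //; exact/measurable_EFinP.
- by move=> n x _; rewrite mule_ge0// lee_fin.
- by move=> x _ a b ab; rewrite lee_wpmul2r// lee_fin; exact: hnd.
Qed.

End integral_density.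

(** * Calculus along curves of R^3 *)

Section curves.
Context {R : realType}.
Local Notation leb := (@lebesgue_measure R).
Implicit Types (x y : 'rV[R]_3) (f g : R -> 'rV[R]_3) (t : R).

Lemma cvg_dotmul T (F : set_system T) {FF : Filter F} (f g : T -> 'rV[R]_3) x y :
  f @ F --> x -> g @ F --> y -> (fun s => dotmul (f s) (g s)) @ F --> dotmul x y.
Proof.
move=> fx gy; rewrite dotmul3E; under eq_fun do rewrite dotmul3E.
have c (h : T -> 'rV[R]_3) (z : 'rV[R]_3) (i : 'I_3) :
    h @ F --> z -> (fun s => h s ord0 i) @ F --> z ord0 i.
  move=> hz; apply: (cvg_comp h (fun M : 'rV[R]_3 => M ord0 i) hz).
  exact: coord_continuous.
by do !apply: cvgD; apply: cvgM; exact: c.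
Qed.

Lemma cvg_sqrtr T (F : set_system T) {FF : Filter F} (f : T -> R) (a : R) :
  f @ F --> a -> (fun s => Num.sqrt (f s)) @ F --> Num.sqrt a.
Proof.
by move=> fa; apply: (cvg_comp f (@Num.sqrt R) fa); exact: sqrt_continuous.
Qed.

Lemma is_derive_coord f (df : 'rV[R]_3) t (i : 'I_3) : is_derive t 1 f df ->
  is_derive t 1 (fun s => f s ord0 i) (df ord0 i).
Proof.
move=> [dft fE]; have dfi : derivable (fun s => f s ord0 i) t 1.
  exact: ((derivable_mxP _ _ _).1 dft ord0 i).
by apply: DeriveDef => //; rewrite -fE derive_mx// mxE.
Qed.

Lemma is_derive_row f (df : 'rV[R]_3) t :
  (forall i : 'I_3, is_derive t 1 (fun s => f s ord0 i) (df ord0 i)) ->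
  is_derive t 1 f df.
Proof.
move=> h; have dft : derivable f t 1.
  by apply/derivable_mxP => i j; rewrite ord1; have [] := h j.
apply: DeriveDef => //; rewrite derive_mx//; apply/rowP => i; rewrite mxE.
by rewrite (@derive_val _ _ _ _ _ _ _ (h i)).
Qed.

Lemma is_derive_dotmul f g (df dg : 'rV[R]_3) t :
  is_derive t 1 f df -> is_derive t 1 g dg ->
  is_derive t 1 (fun s => dotmul (f s) (g s)) (dotmul df (g t) + dotmul (f t) dg).
Proof.
move=> hf hg; have hfi := is_derive_coord _ hf; have hgi := is_derive_coord _ hg.
under eq_fun do rewrite dotmul3E.
apply: is_derive_eq; rewrite !dotmul3E /GRing.scale/=; ring.
Qed.

Lemma CauchySchwarz3 x y : dotmul x y ^+ 2 <= dotmul x x * dotmul y y.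
Proof.
rewrite !dotmul3E -subr_ge0.
set a := x ord0 0; set b := x ord0 1; set c := x ord0 2.
set a' := y ord0 0; set b' := y ord0 1; set c' := y ord0 2.
(* Lagrange's identity: the defect is the squared norm of the cross product *)
rewrite [leRHS](_ : _ = (a * b' - b * a') ^+ 2 + (a * c' - c * a') ^+ 2 +
  (b * c' - c * b') ^+ 2); last by ring.
by rewrite !addr_ge0 ?sqr_ge0.
Qed.

Lemma S2_dotmul x : S2 x <-> dotmul x x = 1.
Proof.
rewrite /S2 /= /enorm; split=> [h|->]; last by rewrite sqrtr1.
by rewrite -(sqr_sqrtr (dotmul_ge0 x)) h expr1n.
Qed.

Lemma S2_dotmul_itv x y : S2 x -> S2 y -> -1 <= dotmul x y <= 1.
Proof.
move=> /S2_dotmul xx /S2_dotmul yy; rewrite -ler_norml.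
have := CauchySchwarz3 x y; rewrite xx yy mulr1 -real_normK ?num_real//.
by rewrite expr_le1.
Qed.

End curves.

(** * Spherical curves are at least as long as the angle *)

Section geodesic_lower.
Context {R : realType}.
Local Notation leb := (@lebesgue_measure R).
Implicit Types (x y : 'rV[R]_3) (t : R).

Lemma acos_lt : {in `[-1, 1] &, {mono (@acos R) : a b /~ b < a}}.
Proof.
move=> a b a1 b1; have ac c : c \in `[-1, 1] -> acos c \in `[0, pi].
  by rewrite !in_itv/= => c1; rewrite acos_ge0// acos_lepi.
by rewrite -ltr_cos ?ac// !acosK.
Qed.

Lemma acos_le : {in `[-1, 1] &, {mono (@acos R) : a b /~ b <= a}}.
Proof. by move=> a b a1 b1; rewrite !leNgt acos_lt. Qed.

(** Inside the interval, differentiating |gamma|^2 = 1 shows that gamma is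
    orthogonal to its derivative.  So only the component of [x] orthogonal to
    gamma counts in <x, gamma'>, and its squared norm is 1 - <x, gamma>^2. *)
Lemma sphere_curve_dotmul_le x y gamma t : sphere_curve x y gamma ->
  t \in `]0, 1[ ->
  `|dotmul x (derive1 gamma t)| <=
    Num.sqrt (1 - dotmul x (gamma t) ^+ 2) * enorm (derive1 gamma t).
Proof.
move=> [g0 g1 gS _] t01.
have /gS[St dt] : t \in `[0, 1] by exact: subset_itv_oo_cc.
have Sx : S2 x.
  by rewrite -g0; apply: (gS _ _).1; rewrite in_itv/= lexx ler01.
have gg1 := (S2_dotmul (gamma t)).1 St; have xx1 := (S2_dotmul x).1 Sx.
have ort : dotmul (gamma t) (derive1 gamma t) = 0.
  have dt' : is_derive t 1 gamma (derive1 gamma t) by rewrite derive1E; exact: DeriveDef.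
  have := is_derive_dotmul dt' dt'; rewrite [dotmul (derive1 _ _) _]dotmulC => -[_ e].
  have : 'D_1 (fun s => dotmul (gamma s) (gamma s)) t = 'D_1 (cst (1 : R)) t.
    apply: near_eq_derive; rewrite ?oner_neq0//.
    near=> s; apply/S2_dotmul; apply: (gS _ _).1; apply: subset_itv_oo_cc.
    by near: s; exact: near_in_itvoo.
  by rewrite e derive_cst => /eqP; rewrite -mulr2n mulrn_eq0/= => /eqP.
have := CauchySchwarz3 (x - dotmul x (gamma t) *: gamma t) (derive1 gamma t).
set u := dotmul x (gamma t); set v := derive1 gamma t.
have -> : dotmul (x - u *: gamma t) v = dotmul x v.
  by rewrite dotmulDl dotmulNl dotmulZl ort mulr0 subr0.
have -> : dotmul (x - u *: gamma t) (x - u *: gamma t) = 1 - u ^+ 2.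
  rewrite !(dotmulDl, dotmulDr, dotmulNl, dotmulNr, dotmulZl, dotmulZr).
  by rewrite gg1 xx1 [dotmul (gamma t) x]dotmulC -/u; ring.
move=> h; rewrite -sqrtr_sqr -sqrtrM; first exact: ler_wsqrtr.
have := S2_dotmul_itv Sx St; rewrite -/u -ler_norml => u1.
by rewrite subr_ge0 -real_normK ?num_real// expr_le1.
Unshelve. all: by end_near. Qed.

(** The angle acos <x, gamma t> has derivative at most |gamma' t|.  As acos is
    not differentiable at 1, where the angle starts, nor at -1, this is applied
    to acos (l <x, gamma t>) for l < 1, and l tends to 1 afterwards. *)
Lemma acos_le_curve_length x y gamma : sphere_curve x y gamma ->
  acos (dotmul x y) <= curve_length gamma.
Proof.
move=> H; have [g0 g1 gS cdg] := H.
move/subspace_continuousP : (cdg) => cdg'.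
have i01 : 0 \in `[0, 1 : R] by rewrite in_itv/= lexx ler01.
have i11 : 1 \in `[0, 1 : R] by rewrite in_itv/= lexx ler01.
have Sx : S2 x by rewrite -g0; exact: (gS _ i01).1.
have Sy : S2 y by rewrite -g1; exact: (gS _ i11).1.
pose u t := dotmul x (gamma t).
pose u' t := dotmul x (derive1 gamma t).
have u1 t : t \in `[0, 1] -> `|u t| <= 1.
  by move=> t01; rewrite ler_norml; apply: S2_dotmul_itv => //; exact: (gS _ t01).1.
have du t : t \in `[0, 1] -> is_derive t 1 u (u' t).
  move=> t01; have dt : is_derive t 1 gamma (derive1 gamma t).
    by rewrite derive1E; apply: DeriveDef => //; exact: (gS _ t01).2.
  have := is_derive_dotmul (is_derive_cst x t 1) dt.
  by rewrite dotmul0l add0r.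
have main (l : R) : 0 < l < 1 ->
    acos (l * dotmul x y) - acos l <= curve_length gamma.
  move=> /andP[l0 l1].
  have lu t : t \in `[0, 1] -> `|l * u t| < 1.
    move=> t01; rewrite normrM gtr0_norm// (le_lt_trans _ l1)//.
    by rewrite ler_piMr ?u1// ltW.
  pose f t := - (Num.sqrt (1 - (l * u t) ^+ 2))^-1 * (l * u' t).
  have dF t : t \in `[0, 1] -> is_derive t 1 (fun s => acos (l * u s)) (f t).
    move=> t01.
    have := du _ t01 => dut.
    have lut : is_derive t 1 (fun s => l * u s) (l * u' t).
      exact: is_deriveZ.
    apply: (@is_derive1_comp _ (@acos R) (fun s => l * u s)).
    by apply: is_derive1_acos; rewrite -ltr_norml; exact: lu.
  have cf : {within `[0, 1], continuous f}.
    apply/subspace_continuousP => t t01.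
    have cu : u @ within `[0, 1] (nbhs t) --> u t.
      apply: cvg_within_filter; apply: differentiable_continuous.
      by apply/derivable1_diffP; have [] := du t t01.
    have cu' : u' @ within `[0, 1] (nbhs t) --> u' t.
      by apply: cvg_dotmul; [exact: cvg_cst|exact: cdg' t t01].
    have clu : (fun s => l * u s) @ within `[0, 1] (nbhs t) --> l * u t.
      exact: cvgM (cvg_cst _) cu.
    apply: cvgM; last exact: cvgM (cvg_cst _) cu'.
    apply: cvgN; apply: cvgV.
      by rewrite gt_eqF// sqrtr_gt0 subr_gt0 -real_normK ?num_real// expr_lt1// lu.
    apply: cvg_sqrtr.
    by apply: cvgB; [exact: cvg_cst|under eq_fun do rewrite expr2; exact: cvgM].
  have cF t : t \in `[0, 1] -> {for t, continuous (fun s => acos (l * u s))}.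
    move=> t01; apply: differentiable_continuous.
    by apply/derivable1_diffP; have [] := dF t t01.
  have LR : derivable_oo_LRcontinuous (fun s => acos (l * u s)) 0 1.
    split=> [t /subset_itv_oo_cc t01| |].
    - by have [] := dF t t01.
    - by apply: cvg_at_right_filter; exact: cF.
    - by apply: cvg_at_left_filter; exact: cF.
  have F'E : {in `]0, 1[, derive1 (fun s => acos (l * u s)) =1 f}.
    move=> t /subset_itv_oo_cc t01.
    by rewrite derive1E (@derive_val _ _ _ _ _ _ _ (dF t t01)).
  have := continuous_FTC2 (ltr01) cf LR F'E.
  rewrite /u g0 g1 ((S2_dotmul x).1 Sx) mulr1 -EFinB => ftc.
  pose v t := enorm (derive1 gamma t).
  have cv : {within `[0, 1], continuous v}.
    apply/subspace_continuousP => t t01.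
    apply: cvg_sqrtr.
    by apply: cvg_dotmul; exact: cdg' t t01.
  have iv : leb.-integrable `[0, 1] (EFin \o v).
    by apply: continuous_compact_integrable => //; exact: segment_compact.
  have if' : leb.-integrable `[0, 1] (EFin \o f).
    by apply: continuous_compact_integrable => //; exact: segment_compact.
  have sub : `]0, 1[ `<=` `[0, 1 : R] by exact: subset_itv_oo_cc.
  have iv' : leb.-integrable `]0, 1[ (EFin \o v) by exact: integrableS iv.
  have if'' : leb.-integrable `]0, 1[ (EFin \o f) by exact: integrableS if'.
  rewrite -lee_fin -ftc /curve_length /Rintegral fineK; last exact: integrable_fin_num iv.
  rewrite integral_itv_bndoo; last exact: measurable_int if''.
  rewrite [leRHS]integral_itv_bndoo; last exact: measurable_int iv'.
  apply: le_integral => // t; rewrite inE/= => t01 /=; rewrite lee_fin.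
  have t01' := sub _ t01.
  have := sphere_curve_dotmul_le H t01; rewrite -/(u t) -/(u' t) -/(v t) => h.
  have s0 : 0 < Num.sqrt (1 - (l * u t) ^+ 2).
    by rewrite sqrtr_gt0 subr_gt0 -real_normK ?num_real// expr_lt1// lu.
  rewrite /f mulNr -mulrN mulrC ler_pdivrMr//.
  apply: (@le_trans _ _ `|u' t|).
    rewrite (le_trans (ler_norm _))// normrN normrM gtr0_norm//.
    by rewrite ler_piMl// ltW.
  rewrite (le_trans h)// mulrC ler_wpM2l ?enorm_ge0// ler_wsqrtr//.
  rewrite lerD2l lerN2 exprMn ler_piMl ?sqr_ge0//.
  by rewrite expr_le1// ltW.
(* A length of at least pi exceeds every angle.  Otherwise the claim amounts to
   cos L <= <x, y>; it is the limit of cos (L + e) <= cos e * <x, y>, which is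
   the case l = cos e of [main], so that only the continuity of cos is used. *)
have [Lpi|piL] := ltP (curve_length gamma) pi; last first.
  by rewrite (le_trans _ piL)// acos_lepi// S2_dotmul_itv.
have xy1 := S2_dotmul_itv Sx Sy.
have L0 : 0 <= curve_length gamma.
  by apply: Rintegral_ge0 => t _; exact: enorm_ge0.
set d := dotmul x y in xy1 main *; set L := curve_length gamma in Lpi L0 main *.
suff h : cos L <= d.
  rewrite -[leRHS]cosK ?in_itv/= ?L0 ?(ltW Lpi)// acos_le ?in_itv//=.
  by rewrite cos_geN1 cos_le1.
have cvgh : (fun e => cos e * d - cos (L + e)) @ 0^'+ --> cos 0 * d - cos (L + 0).
  apply: cvg_at_right_filter; apply: cvgB.
    by apply: cvgM; [exact: continuous_cos|exact: cvg_cst].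
  apply: (cvg_comp (fun e => L + e) (@cos R)); last exact: continuous_cos.
  by apply: cvgD; [exact: cvg_cst|exact: cvg_id].
rewrite -subr_ge0 -[L]addr0 -[d]mul1r -(@cos0 R); apply: (cvgr_to_ge cvgh).
near=> e.
have e0 : 0 < e by near: e; exact: nbhs_right_gt.
have epi2 : e < pi / 2 by near: e; apply: nbhs_right_lt; rewrite divr_gt0// pi_gt0.
have eL : e < pi - L by near: e; apply: nbhs_right_lt; rewrite subr_gt0.
have epi : e < pi by lra.
have l0 : 0 < cos e by rewrite cos_gt0_pihalf// epi2 andbT; lra.
have l1 : cos e < 1.
  by rewrite -(@cos0 R) ltr_cos// in_itv/= ?lexx ?pi_ge0// !ltW.
have := main (cos e); rewrite l0 l1 => /(_ isT).
have -> : acos (cos e) = e by rewrite cosK// in_itv/= !ltW.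
rewrite lerBlDr -[L + e]cosK; last first.
  by rewrite in_itv/=; apply/andP; split; lra.
have ld1 : cos e * d \in `[-1, 1].
  by rewrite in_itv/= -ler_norml normrM mulr_ile1// ler_norml// cos_geN1 cos_le1.
have cL1 : cos (L + e) \in `[-1, 1] by rewrite in_itv/= cos_geN1 cos_le1.
by rewrite acos_le// acosK// subr_ge0.
Unshelve. all: by end_near. Qed.

End geodesic_lower.

(** * The geodesic distance is the angle *)

Section geodesic.
Context {R : realType}.
Local Notation leb := (@lebesgue_measure R).
Implicit Types (x y v : 'rV[R]_3) (t : R).

Lemma enorm_eq0 n (x : 'rV[R]_n) : (enorm x == 0) = (x == 0).
Proof. by rewrite sqrtr_eq0 -dotmul_eq0 eq_le dotmul_ge0 andbT. Qed.

Lemma enorm_gt0 n (x : 'rV[R]_n) : (0 < enorm x) = (x != 0).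
Proof. by rewrite lt_def enorm_eq0 enorm_ge0 andbT. Qed.

Lemma S2_pr v : v != 0 -> S2 (pr v).
Proof.
move=> v0; apply/S2_dotmul; rewrite /pr dotmulZl dotmulZr.
rewrite -(sqr_sqrtr (dotmul_ge0 v)) -/(enorm v); field.
by rewrite enorm_eq0.
Qed.

Lemma exists_S2_orthogonal x : exists2 e, S2 e & dotmul x e = 0.
Proof.
suff [v v0 xv] : exists2 v, v != 0 & dotmul x v = 0.
  by exists (pr v); [exact: S2_pr|rewrite dotmulZr xv mulr0].
have [/eqP x0|x0] := boolP (x ord0 0 == 0).
  exists (vec3 1 0 0); last by rewrite dotmul3E !mxE/= x0; ring.
  by rewrite -dotmul_eq0 dotmul3E !mxE/= !mulr0 !addr0 mulr1 oner_eq0.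
exists (vec3 (- x ord0 1) (x ord0 0) 0); last by rewrite dotmul3E !mxE/=; ring.
by apply: contra x0 => /eqP /rowP/(_ 1); rewrite !mxE/= => ->.
Qed.

Let circle (a : R) x y t := cos (a * t) *: x + sin (a * t) *: y.

Let is_derive_circle a x y t :
  is_derive t 1 (circle a x y) (circle a (a *: y) (- a *: x) t).
Proof.
apply: is_derive_row => i; rewrite /circle !mxE; under eq_fun do rewrite !mxE.
have dat : is_derive t 1 (fun s => a * s) a.
  by apply: is_derive_eq; rewrite /GRing.scale/= mulr1.
have dcos := is_derive1_comp (is_derive_cos (a * t)) dat.
have dsin := is_derive1_comp (is_derive_sin (a * t)) dat.
apply: is_derive_eq; rewrite /GRing.scale/=; ring.
Qed.

(** The curve is t |-> cos (a t) x + sin (a t) e, where [a] is the angle and [e]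
    the unit vector orthogonal to [x] in the plane of [x] and [y].  When [y] is
    [x] or [- x] this plane is not determined, and any [e] orthogonal to [x]
    will do. *)
Lemma great_circle x y : S2 x -> S2 y ->
  exists2 gamma, sphere_curve x y gamma & curve_length gamma = acos (dotmul x y).
Proof.
move=> Sx Sy; have xx := (S2_dotmul x).1 Sx; have yy := (S2_dotmul y).1 Sy.
have xy1 := S2_dotmul_itv Sx Sy.
set d := dotmul x y in xy1 *; set a := acos d.
have ca : cos a = d by rewrite acosK.
have sa : sin a ^+ 2 = 1 - d ^+ 2 by rewrite sin2cos2 ca.
have zz : dotmul (y - d *: x) (y - d *: x) = sin a ^+ 2.
  rewrite sa !(dotmulDl, dotmulDr, dotmulNl, dotmulNr, dotmulZl, dotmulZr).
  by rewrite xx yy [dotmul y x]dotmulC -/d; ring.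
have [e [Se xe ye]] : exists e,
    [/\ S2 e, dotmul x e = 0 & y = cos a *: x + sin a *: e].
  have [sa0|sa0] := eqVneq (sin a) 0.
    have [e Se xe] := exists_S2_orthogonal x; exists e; split => //.
    move: zz; rewrite sa0 expr0n/= => /eqP; rewrite dotmul_eq0 subr_eq0 => /eqP.
    by rewrite scale0r addr0 ca.
  exists ((sin a)^-1 *: (y - d *: x)); split.
  - by apply/S2_dotmul; rewrite dotmulZl dotmulZr zz; field.
  - by rewrite dotmulZr dotmulDr dotmulNr dotmulZr xx -/d mulr1 subrr mulr0.
  - by rewrite scalerA mulfV// scale1r ca addrC subrK.
have ee := (S2_dotmul e).1 Se.
exists (circle a x e).
  split.
  - by rewrite /circle mulr0 cos0 sin0 scale0r addr0 scale1r.
  - by rewrite /circle mulr1 -ye.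
  - move=> t _; split; last by have [] := is_derive_circle a x e t.
    apply/S2_dotmul; rewrite !(dotmulDl, dotmulDr, dotmulZl, dotmulZr).
    rewrite xx ee [dotmul e x]dotmulC xe -[RHS](cos2Dsin2 (a * t)); ring.
  - rewrite (_ : derive1 _ = circle a (a *: e) (- a *: x)); last first.
      apply/funext => t; rewrite derive1E.
      by rewrite (@derive_val _ _ _ _ _ _ _ (is_derive_circle a x e t)).
    apply: derivable_within_continuous => t _.
    by have [] := is_derive_circle a (a *: e) (- a *: x) t.
have a0 : 0 <= a by exact: acos_ge0.
rewrite /curve_length (_ : (fun _ => _) = cst a); last first.
  apply/funext => t; rewrite derive1E.
  rewrite (@derive_val _ _ _ _ _ _ _ (is_derive_circle a x e t)) /enorm /circle.
  rewrite !(dotmulDl, dotmulDr, dotmulZl, dotmulZr) xx ee [dotmul e x]dotmulC xe.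
  rewrite [X in Num.sqrt X](_ : _ = a ^+ 2 * (cos (a * t) ^+ 2 + sin (a * t) ^+ 2)).
    by rewrite cos2Dsin2 mulr1 sqrtr_sqr ger0_norm.
  by ring.
by rewrite Rintegral_cst//= lebesgue_measure_itv/= lte01/= subr0 mulr1.
Qed.

Lemma geodistE x y : S2 x -> S2 y -> geodist x y = acos (dotmul x y).
Proof.
move=> Sx Sy; have [gamma hg gE] := great_circle Sx Sy.
apply/eqP; rewrite eq_le; apply/andP; split.
  rewrite -gE; apply: ge_inf; last by exists gamma.
  by exists (acos (dotmul x y)) => _ [g' hg' <-]; exact: acos_le_curve_length.
apply: lb_le_inf; first by exists (curve_length gamma), gamma.
by move=> _ [g' hg' <-]; exact: acos_le_curve_length.
Qed.

End geodesic.

(** * The tangent substitution *)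

Section tangent_substitution.
Context (R : realType).
Local Notation mR := (measurableTypeR R).
Local Notation leb := (@lebesgue_measure R).

Local Notation D := (`](- (pi / 2))%R, (pi / 2)%R[%classic : set mR).

Let cosD (s : R) : D s -> 0 < cos s.
Proof. by rewrite /= in_itv/= => sD; exact: cos_gt0_pihalf. Qed.

Let mD : measurable D. Proof. exact: measurable_itv. Qed.

Lemma measurable_tan : measurable_fun D (tan : mR -> mR).
Proof.
apply: open_continuous_measurable_fun; first exact: interval_open.
by move=> s /[!inE] sD; apply: continuous_tan; rewrite gt_eqF ?cosD.
Qed.

Lemma measurable_sec2 : measurable_fun D (fun s : mR => ((cos s) ^- 2)%:E).
Proof.
apply/measurable_EFinP; apply: open_continuous_measurable_fun; first exact: interval_open.
move=> s /[!inE] sD; apply: cvgV; first by rewrite expf_neq0// gt_eqF ?cosD.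
by under eq_fun do rewrite expr2; apply: cvgM; exact: continuous_cos.
Qed.

Let m (A : set mR) : \bar R :=
  (\int[leb]_(s in D `&` tan @^-1` A) ((cos s) ^- 2)%:E)%E.

Let m0 : m set0 = 0%E.
Proof. by rewrite /m preimage_set0 setI0 integral_set0. Qed.

Let m_ge0 A : (0 <= m A)%E.
Proof. by apply: integral_ge0 => s _; rewrite lee_fin invr_ge0 sqr_ge0. Qed.

Let m_sigma_additive : semi_sigma_additive m.
Proof.
move=> F mF tF mUF; rewrite /m preimage_bigcup setI_bigcupr.
rewrite ge0_integral_bigcup/=.
- by apply: is_cvg_ereal_nneg_natsum_cond => // n _ _; exact: m_ge0.
- by move=> k; exact: measurable_tan.
- by apply: measurable_funS measurable_sec2 => // s [k _ []].
- by move=> s _; rewrite lee_fin invr_ge0 sqr_ge0.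
- apply/trivIsetP => i j _ _ ij; rewrite setIACA setIid -preimage_setI.
  by move/trivIsetP : tF => ->//; rewrite preimage_set0 setI0.
Qed.

Let m_measure : {measure set mR -> \bar R} :=
  HB.pack m (isMeasure.Build _ _ _ m m0 m_ge0 m_sigma_additive).

(** The right-hand side is a measure in [A], whose value on half-open intervals
    is given by the fundamental theorem of calculus. *)
Lemma lebesgue_measure_tan (A : set R) : measurable A ->
  leb A = (\int[leb]_(s in `](- (pi / 2))%R, (pi / 2)%R[ `&` tan @^-1` A)
    ((cos s) ^- 2)%:E)%E.
Proof.
apply: (@lebesgue_measure_unique R m_measure) => _ [[a b] _ <-] /=; rewrite /m.
have [ab|ba] := ltP a b; last first.
  rewrite set_itv_ge ?bnd_simp -?leNgt// measure0 preimage_set0 setI0.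
  by rewrite integral_set0.
have inD (t : R) : atan t \in `](- (pi / 2)), (pi / 2)[.
  by rewrite in_itv/= atan_gtNpi2 atan_ltpi2.
have atan_lt (t s : R) : s \in `](- (pi / 2)), (pi / 2)[ ->
    (atan t < s) = (t < tan s).
  by move=> sD; rewrite -{2}[t]atanK ltr_tan.
have atan_ge (t s : R) : s \in `](- (pi / 2)), (pi / 2)[ ->
    (s <= atan t) = (tan s <= t).
  by move=> sD; rewrite !leNgt atan_lt.
have -> : D `&` tan @^-1` `]a, b] = `]atan a, atan b]%classic.
  apply/seteqP; split => s /=; rewrite !in_itv/=.
    move=> [sD /andP[h1 h2]]; have sD' : s \in `](- (pi / 2)), (pi / 2)[ by [].
    by rewrite atan_lt// h1 atan_ge.
  move=> /andP[h1 h2]; have sD : s \in `](- (pi / 2)), (pi / 2)[.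
    by rewrite in_itv/= (lt_trans (atan_gtNpi2 a) h1) (le_lt_trans h2 (atan_ltpi2 b)).
  by split; [|rewrite -atan_lt// h1 -atan_ge].
have atab : atan a < atan b by exact: lt_atan.
have sub s : s \in `[atan a, atan b] -> 0 < cos s.
  rewrite in_itv/= => /andP[h1 h2]; apply: cosD; rewrite /= in_itv/=.
  by rewrite (lt_le_trans (atan_gtNpi2 a) h1) (le_lt_trans h2 (atan_ltpi2 b)).
rewrite integral_itv_obnd_cbnd; last first.
  apply: measurable_funS measurable_sec2 => // s; rewrite /= !in_itv/= => /andP[h1 h2].
  by rewrite (lt_trans (atan_gtNpi2 a) h1) (le_lt_trans h2 (atan_ltpi2 b)).
rewrite (@continuous_FTC2 _ _ (@tan R))//.
- by rewrite !atanK lebesgue_measure_itv/= lte_fin ab.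
- apply: continuous_in_subspaceT => s /[!inE] /sub cs.
  apply: cvgV; first by rewrite expf_neq0// gt_eqF.
  by under eq_fun do rewrite expr2; apply: cvgM; exact: continuous_cos.
- split.
  + by move=> s /subset_itv_oo_cc /sub cs; apply: derivable_tan; rewrite gt_eqF.
  + apply: cvg_at_right_filter; apply: continuous_tan.
    by rewrite gt_eqF// sub// in_itv/= lexx ltW.
  + apply: cvg_at_left_filter; apply: continuous_tan.
    by rewrite gt_eqF// sub// in_itv/= lexx ltW.
- move=> s /subset_itv_oo_cc /sub cs; rewrite derive1E.
  by rewrite (@derive_val _ _ _ _ _ _ _ (is_derive_tan _)) ?gt_eqF.
Qed.

End tangent_substitution.

(** * Negligible sets on the line *)

Section null_sets.
Context (R : realType).
Local Notation mR := (measurableTypeR R).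
Local Notation leb := (@lebesgue_measure R).

Lemma negligible_preimage_affine (a b : R) (A : set R) : a != 0 ->
  leb.-negligible A -> leb.-negligible ((fun t : R => a * t + b) @^-1` A).
Proof.
move=> a0 [N [mN N0 AN]]; exists ((fun t : R => a * t + b) @^-1` N); split.
- by rewrite -[X in measurable X]setTI; exact: measurable_affine.
- have /eqP := lebesgue_measure_affine b a0 mN.
  by rewrite N0 eq_sym mule_eq0 eqe normr_eq0 (negPf a0)/= => /eqP.
- exact: preimage_subset.
Qed.

Lemma ge0_integral_eq0 d (T : measurableType d) (mu : {measure set T -> \bar R})
    (f : T -> \bar R) : measurable_fun setT f -> (forall x, 0 <= f x)%E ->
  (\int[mu]_x f x = 0)%E -> mu.-negligible [set x | f x != 0%E].
Proof.
move=> mf f0 If0; have : ae_eq mu setT f (cst 0%E).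
  apply/ae_eq_integral_abs => //; rewrite -[RHS]If0.
  by apply: eq_integral => x _; rewrite gee0_abs.
by apply: negligibleS => x /= /eqP fx0 /(_ I).
Qed.

(** The affine map s |-> pi / 2 - s turns the domain of integration in
    [lebesgue_measure_tan] into the preimage of [A] by the cotangent. *)
Lemma negligible_cot (A : set R) : measurable A ->
  leb.-negligible [set t | 0 < t < pi /\ A (cos t / sin t)] -> leb A = 0%E.
Proof.
move=> mA An; rewrite lebesgue_measure_tan//.
set B := (X in (\int[_]_(_ in X) _)%E).
have mB : measurable B by exact: measurable_tan.
rewrite null_set_integral//.
- by apply: measurable_funS (@measurable_sec2 R) => // t [].
- apply/negligibleP => //.
  have := @negligible_preimage_affine (-1) (pi / 2) _ _ An.
  rewrite oppr_eq0 oner_eq0 => /(_ isT); apply: negligibleS => s [/=].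
  rewrite in_itv/= => /andP[s1 s2] As; split; first by apply/andP; split; lra.
  by rewrite mulN1r addrC cosB sinB cos_pihalf sin_pihalf !mul0r add0r !mul1r subr0.
Qed.

End null_sets.

(** * Cones over sets of zero area *)

Section sphere_null_sets.
Context (R : realType).
Local Notation mR := (measurableTypeR R).
Local Notation leb := (@lebesgue_measure R).

(** By Tonelli's theorem, almost every meridian has a negligible intersection
    with [A]; the weight sin t can be dropped since it is positive inside
    meridians. *)
Lemma dVol0_meridian (A : set 'rV[R]_3) : measurable A -> dVol A = 0%E ->
  leb.-negligible [set p | 0 <= p < 2 * pi /\
    ~ leb.-negligible [set t | 0 < t < pi /\ A (sph_coord (t, p))]].
Proof.
move=> mA A0; set E := sph_dom `&` sph_coord @^-1` A.
have mE : measurable (E : set (mR * mR)).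
  apply: measurableI; first exact: measurable_sph_dom.
  by rewrite -[X in measurable X]setTI; exact: measurable_sph_coord.
pose F : mR * mR -> \bar R := (EFin \o sph_area) \_ E.
have mF : measurable_fun [set: mR * mR] F.
  apply/(measurable_restrictT _ _).1 => //; apply/measurable_EFinP/measurable_funTS.
  exact: measurable_sph_area.
have F0 u : (0 <= F u)%E.
  by rewrite /F patchE; case: ifPn => // _; rewrite lee_fin sqrtr_ge0.
have If0 : (\int[leb]_p \int[leb]_t F (t, p) = 0)%E.
  rewrite -[RHS]A0 /dVol [RHS]integral_mkcond.
  transitivity (\int[leb \x leb]_u F u)%E; last by [].
  by rewrite (fubini_tonelli2 _ mF F0).
have mG : measurable_fun [set: mR] (fun p => \int[leb]_t F (t, p))%E.
  exact: (measurable_fun_fubini_tonelli_G _ mF F0).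
have G0 p : (0 <= \int[leb]_t F (t, p))%E by apply: integral_ge0 => t _; exact: F0.
have := ge0_integral_eq0 mG G0 If0.
apply: negligibleS => p /= [p2 Ap]; apply/negP => /eqP Ip0; apply: Ap.
have mFp : measurable_fun [set: mR] (fun t => F (t, p)).
  by apply: measurableT_comp => //; exact: measurable_pair2.
have := ge0_integral_eq0 mFp (fun t => F0 (t, p)) Ip0.
apply: negligibleS => t /= [/andP[t0 tpi] At].
rewrite /F patchE mem_set.
  by rewrite /= sph_areaE eqe normr_eq0 gt_eqF// sin_gt0_pi// t0.
by split=> //; split; rewrite /= in_itv//= !ltW.
Qed.

Lemma prZ n c (x : 'rV[R]_n) : 0 < c -> pr (c *: x) = pr x.
Proof.
move=> c0; rewrite /pr /enorm dotmulZl dotmulZr mulrA -expr2 sqrtrM ?sqr_ge0//.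
by rewrite sqrtr_sqr gtr0_norm// invfM scalerA mulrAC mulVf ?mul1r// gt_eqF.
Qed.

Lemma S2_sph_coord u : S2 (@sph_coord R u).
Proof.
apply/S2_dotmul; rewrite dotmul3E !mxE/=.
transitivity (sin u.1 ^+ 2 * (cos u.2 ^+ 2 + sin u.2 ^+ 2) + cos u.1 ^+ 2).
  by ring.
by rewrite cos2Dsin2 mulr1 addrC cos2Dsin2.
Qed.

Lemma pr_S2 (x : 'rV[R]_3) : S2 x -> pr x = x.
Proof. by rewrite /S2 /pr /= => ->; rewrite invr1 scale1r. Qed.

Section cone.
Variable C : set 'rV[R]_3.
Hypotheses (mC : measurable C) (coneC : forall c x, 0 < c -> C x -> C (c *: x)).

Lemma measurable_fibre (a b : R) : measurable [set z : mR | C (vec3 a b z)].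
Proof.
rewrite -[X in measurable X]setTI.
have mv : measurable_fun [set: mR] (fun z : mR => vec3 a b z : 'rV[R]_3).
  by apply: measurable_vec3.
exact: mv.
Qed.

(** Divided by sin t, the point of the hypothesis is the point of height cot t on
    the vertical line over (c a, c b).  So the cone meets this line in a
    negligible set, and by scaling also the line over (a, b). *)
Lemma cone_fibre (a b c : R) : 0 < c ->
  leb.-negligible [set t | 0 < t < pi /\
    C (vec3 (sin t * (c * a)) (sin t * (c * b)) (cos t))] ->
  leb [set z | C (vec3 a b z)] = 0%E.
Proof.
move=> c0 h; apply/negligibleP; first exact: measurable_fibre.
have : leb.-negligible [set z | C (vec3 (c * a) (c * b) z)].
  apply/negligibleP; first exact: measurable_fibre.
  apply: negligible_cot; first exact: measurable_fibre.
  apply: negligibleS h => t /= [t0 Ct]; split=> //.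
  have st : 0 < sin t by rewrite sin_gt0_pi.
  have := coneC st Ct; congr (C _); apply: row3_ext; rewrite !mxE//=.
  by rewrite mulrCA mulfV ?mulr1// gt_eqF.
move=> /(negligible_preimage_affine 0 (lt0r_neq0 c0)).
apply: negligibleS => z /= Cz; have := coneC c0 Cz; congr (C _).
by apply: row3_ext; rewrite !mxE//= addr0.
Qed.

End cone.

(** The preimage of [A] is a cone.  In a plane of constant [y] <> 0, the vertical
    line at x = y cot p lies over the meridian of longitude p if y > 0 and p + pi
    if y < 0.  By [dVol0_meridian] and [cone_fibre] its intersection with the
    cone is negligible for almost every p, hence for almost every x by
    [negligible_cot]. *)
Lemma dVol0_leb3_pr (A : set 'rV[R]_3) : measurable A -> dVol A = 0%E ->
  lebesgue_measure3 (@pr R 3 @^-1` A) = 0%E.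
Proof.
move=> mA A0; have N := dVol0_meridian mA A0.
set C := _ @^-1` A.
have mC : measurable C by rewrite -[X in measurable X]setTI; exact: measurable_pr.
have coneC c x : 0 < c -> C x -> C (c *: x).
  by move=> c0; rewrite /C /= prZ.
have C_sph u : C (sph_coord u) = A (sph_coord u).
  by rewrite /C /= pr_S2//; exact: S2_sph_coord.
pose f (x : 'rV[R]_3) : \bar R := (\1_C x)%:E.
have mf : measurable_fun setT f by apply/measurable_EFinP; exact: measurable_indic.
have f0 x : (0 <= f x)%E by rewrite lee_fin.
transitivity (\int[lebesgue_measure3]_x f x)%E.
  by rewrite /f integral_indic ?setIT.
rewrite (leb3_yxz mf f0).
have mvz (y : R) : measurable_fun [set: mR * mR]
    (fun u : mR * mR => vec3 u.1 y u.2 : 'rV[R]_3).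
  by apply: measurable_vec3.
have mH (y : R) : measurable_fun [set: mR] (fun x => \int[leb]_z f (vec3 x y z))%E.
  have mfy : measurable_fun [set: mR * mR] (fun u : mR * mR => f (vec3 u.1 y u.2)).
    exact: (measurableT_comp mf (mvz y)).
  exact: (@measurable_fun_fubini_tonelli_F _ _ mR mR R leb _ mfy (fun=> f0 _)).
have H0 (x y : R) : (0 <= \int[leb]_z f (vec3 x y z))%E.
  by apply: integral_ge0 => z _; exact: f0.
have HE (x y : R) : (\int[leb]_z f (vec3 x y z) = leb [set z | C (vec3 x y z)])%E.
  transitivity (\int[leb]_z (\1_[set z | C (vec3 x y z)] z)%:E)%E; last first.
    by rewrite integral_indic ?setIT//; exact: measurable_fibre.
  by apply: eq_integral => z _; rewrite /f !indicE; congr ((nat_of_bool _)%:R%:E).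
have main (y : R) : y != 0 -> (\int[leb]_x \int[leb]_z f (vec3 x y z) = 0)%E.
  move=> y0; pose S := [set x : mR | (\int[leb]_z f (vec3 x y z) != 0)%E].
  have mS : measurable S.
    by rewrite -[S]setTI; exact: emeasurable_neq.
  suff S0 : leb S = 0%E.
    rewrite (ge0_negligible_integral mS _ _ _ S0)//.
    by apply: integral0_eq => x [_ /= /negP]; rewrite negbK => /eqP.
  apply/negligibleP => //.
  pose S' := (fun s : R => y * s + 0) @^-1` S.
  have mS' : measurable (S' : set mR).
    by rewrite -[S']setTI; exact: measurable_affine.
  have : leb S' = 0%E.
    apply: negligible_cot => //.
    (* p + e is the longitude, which exceeds pi in the half-space y < 0 *)
    pose e := if y < 0 then pi else 0 : R.
    have := negligible_preimage_affine e (oner_neq0 R) N.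
    apply: negligibleS => p [/andP[p0 ppi]] Sp.
    have {}Sp : leb [set z | C (vec3 (y * (cos p / sin p) + 0) y z)] != 0%E.
      by rewrite -HE.
    split.
      by rewrite mul1r /e; case: ifPn => _; apply/andP; split; lra.
    move=> h; move/eqP : Sp; apply.
    have sp : 0 < sin p by rewrite sin_gt0_pi// p0.
    apply: (@cone_fibre C mC coneC _ _ (sin p / `|y|)).
      by rewrite divr_gt0// normr_gt0.
    apply: negligibleS h => t /= [t0 Ct]; split => //.
    rewrite -C_sph /sph_coord/=; move: Ct; congr (C (vec3 (_ * _) (_ * _) _)).
      rewrite addr0 mul1r /e; case: ltP => yy.
        by rewrite cosDpi ltr0_norm//; field; rewrite y0 gt_eqF.
      by rewrite addr0 ger0_norm//; field; rewrite y0 gt_eqF.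
    rewrite mul1r /e; case: ltP => yy.
      by rewrite sinDpi ltr0_norm//; field.
    by rewrite addr0 ger0_norm//; field.
  move=> S'0; have : leb.-negligible S' by apply/negligibleP.
  move=> /(negligible_preimage_affine 0 (_ : y^-1 != 0)); rewrite invr_eq0 => /(_ y0).
  apply: negligibleS => x; rewrite /S' /=.
  by rewrite !addr0 mulrA mulfV// mul1r.
rewrite -(@integral_setD1 _ _ 0)//.
- by apply: integral0_eq => y [_ /= /eqP y0]; exact: main.
- by apply: measurableD.
- apply: measurable_funTS.
  apply: (measurable_fun_fubini_tonelli_G _ (measurable_leb3_fibre mf f0)) => u.
  exact: H0.
Qed.

End sphere_null_sets.

(** * Density of the projected normal law *)

Section density_of_projection.
Context (R : realType).
Local Notation mR := (measurableTypeR R).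
Local Notation leb := (@lebesgue_measure R).

Lemma measurable_S2 : measurable (@S2 R).
Proof.
rewrite (_ : S2 = setT `&` @enorm R 3 @^-1` [set 1]).
  exact: measurable_enorm.
by rewrite setTI; apply/seteqP; split.
Qed.

Lemma dVol_lty : (dVol [set: 'rV[R]_3] < +oo)%E.
Proof.
rewrite /dVol preimage_setT setIT.
apply: (@le_lt_trans _ _ (\int[leb \x leb]_(u in sph_dom) 1)%E).
  apply: ge0_le_integral => //.
  - exact: measurable_sph_dom.
  - by move=> u _; rewrite lee_fin sqrtr_ge0.
  - by apply/measurable_EFinP/measurable_funTS; exact: measurable_sph_area.
  - by move=> u _; rewrite sph_areaE lee_fin sin_max.
rewrite integral_cst ?mul1e; last exact: measurable_sph_dom.
rewrite [ltLHS](_ : _ = leb `[0%R, pi] * leb `[0%R, (2 * pi)%R[)%E; last first.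
  exact: (@product_measure1E _ _ mR mR R leb leb).
rewrite !lebesgue_measure_itv/=.
by do 2!case: ifPn => _; rewrite ?mule0 ?mul0e// -!EFinD -EFinM ltry.
Qed.

Let dVol_fin_num : fin_num_fun (@dVol R).
Proof.
move=> A mA; rewrite ge0_fin_numE ?measure_ge0//.
by rewrite (le_lt_trans _ dVol_lty)// le_measure ?inE.
Qed.

Let dVol_fin : {finite_measure set 'rV[R]_3 -> \bar R} :=
  HB.pack (@dVol R) (Measure_isFinite.Build _ _ _ (@dVol R) dVol_fin_num).

Lemma dVol_setCS2 : dVol (~` @S2 R) = 0%E.
Proof.
rewrite /dVol (_ : _ @^-1` _ = set0) ?setI0 ?integral_set0//.
by apply/seteqP; split => u //=; apply; exact: S2_sph_coord.
Qed.

(** This is the Radon-Nikodym theorem for the finite measure [dVol]; since the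
    complement of the sphere is null, integrals over [A] are integrals over the
    part of [A] on the sphere. *)
Lemma dominated_is_density d (T : measurableType d) (P : probability T R)
    (Y : {RV P >-> 'rV[R]_3}) :
  (forall A, measurable A -> dVol A = 0%E -> distribution P Y A = 0%E) ->
  exists p, is_density Y p.
Proof.
move=> dom; have dom' : distribution P Y `<< dVol_fin.
  exact/null_content_dominatesP.
have [f [f0 ffin fint fE]] := radon_nikodym_sigma_finite dom'.
have mf := measurable_int _ fint.
exists (fine \o f); split.
- apply: measurable_funTS; apply: measurableT_comp => //; exact: measurable_fine.
- by move=> y _; rewrite fine_ge0.
- move=> A mA; rewrite fE//.
  rewrite (@ge0_negligible_integral _ _ _ dVol_fin A (~` S2))//.
  + rewrite setDE setCK; apply: eq_integral => y _.
    by rewrite /= fineK.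
  + exact: measurableC measurable_S2.
  + exact: measurable_funTS.
  + exact: dVol_setCS2.
Qed.

End density_of_projection.

Section normal_pdf.
Context (R : realType).
Implicit Types (mu x : 'rV[R]_3).

Lemma mvnormal_pdf3_isotropic mu (sigma : R) x : 0 < sigma ->
  mvnormal_pdf3 mu (sigma ^+ 2)%:M x =
  (Num.sqrt ((2 * pi * sigma ^+ 2) ^+ 3))^-1 *
  expR (- (2 * sigma ^+ 2)^-1 * dotmul (x - mu) (x - mu)).
Proof.
move=> s0; rewrite /mvnormal_pdf3 det_scalar -exprMn; congr (_ * expR _).
rewrite invmx_scalar mul_mx_scalar -scalemxAl mxE -/(dotmul _ _).
by field; rewrite gt_eqF.
Qed.

Lemma measurable_mvnormal_pdf3_isotropic mu (sigma : R) : 0 < sigma ->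
  measurable_fun setT (mvnormal_pdf3 mu (sigma ^+ 2)%:M).
Proof.
move=> s0; rewrite (_ : mvnormal_pdf3 _ _ = fun x : 'rV_3 =>
  (Num.sqrt ((2 * pi * sigma ^+ 2) ^+ 3))^-1 *
  expR (- (2 * sigma ^+ 2)^-1 * dotmul (x - mu) (x - mu))); last first.
  by apply/funext => x; exact: mvnormal_pdf3_isotropic.
apply: measurable_funM => //; apply: (measurableT_comp (@measurable_expR R)).
apply: measurable_funM => //; under eq_fun do rewrite dotmulE.
apply: measurable_sum => i; under eq_fun do rewrite !mxE.
by apply: measurable_funM; apply: measurable_funB => //; exact: measurable_coord.
Qed.

Lemma mvnormal_pdf3_gt0 mu (sigma : R) x : 0 < sigma ->
  0 < mvnormal_pdf3 mu (sigma ^+ 2)%:M x.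
Proof.
move=> s0; rewrite mvnormal_pdf3_isotropic// mulr_gt0 ?expR_gt0// invr_gt0 sqrtr_gt0.
by rewrite exprn_gt0// !mulr_gt0 ?exprn_gt0 ?pi_gt0.
Qed.

Lemma mvnormal_pdf3_lt mu (sigma : R) x y : 0 < sigma ->
  dotmul (x - mu) (x - mu) < dotmul (y - mu) (y - mu) ->
  mvnormal_pdf3 mu (sigma ^+ 2)%:M y < mvnormal_pdf3 mu (sigma ^+ 2)%:M x.
Proof.
move=> s0 xy; rewrite !mvnormal_pdf3_isotropic// ltr_pM2l; last first.
  rewrite invr_gt0 sqrtr_gt0.
  by rewrite exprn_gt0// !mulr_gt0 ?exprn_gt0 ?pi_gt0.
by rewrite ltr_expR ltr_nM2l// oppr_lt0 invr_gt0 mulr_gt0// exprn_gt0.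
Qed.

Lemma normal_pr_is_density d (T : measurableType d) (P : probability T R)
    (X : {RV P >-> 'rV[R]_3}) mu (sigma : R) : 0 < sigma ->
  is_normal3 X mu (sigma ^+ 2)%:M ->
  exists p, is_density (P := P) (@pr R 3 \o X) p.
Proof.
move=> s0 [_ _ XE]; apply: dominated_is_density => A mA A0.
have mB : measurable (@pr R 3 @^-1` A).
  by rewrite -[X in measurable X]setTI; exact: measurable_pr.
have -> : distribution P (@pr R 3 \o X) A = distribution P X (@pr R 3 @^-1` A) by [].
rewrite XE//; apply: null_set_integral => //.
  apply/measurable_EFinP/measurable_funTS; exact: measurable_mvnormal_pdf3_isotropic.
exact: dVol0_leb3_pr.
Qed.

End normal_pdf.

(** * The Fréchet functional as an integral over R^3 *)

Section angle.
Context (R : realType).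
Local Notation mR := (measurableTypeR R).
Implicit Types (q x y : 'rV[R]_3).

Definition sqr_angle q y : R := acos (dotmul q y) ^+ 2.

Lemma measurable_acos_itv : measurable_fun (`[-1, 1] : set mR) (@acos R).
Proof.
apply: (@measurable_fun_itv_cc _ _ _ false true).
apply: open_continuous_measurable_fun; first exact: interval_open.
by move=> t /[!inE]; rewrite /= in_itv/= => t1; exact: continuous_acos.
Qed.

Lemma pr0 : pr (0 : 'rV[R]_3) = 0.
Proof. by rewrite /pr scaler0. Qed.

Lemma dotmul_pr_itv q x : S2 q -> -1 <= dotmul q (pr x) <= 1.
Proof.
move=> Sq; have [->|x0] := eqVneq x 0; last by apply: S2_dotmul_itv => //; exact: S2_pr.
by rewrite pr0 dotmul0r; apply/andP; split; lra.
Qed.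

Lemma sqr_angle_pr_le q x : S2 q -> sqr_angle q (pr x) <= pi ^+ 2.
Proof.
move=> Sq; have h := dotmul_pr_itv x Sq.
by rewrite ler_sqr ?nnegrE ?acos_ge0 ?pi_ge0// acos_lepi.
Qed.

(** The set where the arc cosine is meaningful: when [q] is a unit vector, it
    contains not only the sphere but every value of [pr], even [pr 0 = 0]. *)
Definition angle_dom q : set 'rV[R]_3 := [set y | -1 <= dotmul q y <= 1].

Lemma measurable_angle_dom q : measurable (angle_dom q).
Proof.
rewrite (_ : angle_dom q = setT `&` dotmul q @^-1` `[-1, 1]).
  exact: measurable_dotmul.
by rewrite setTI; apply/seteqP; split=> y; rewrite /angle_dom /= in_itv.
Qed.

Lemma measurable_sqr_angle q : measurable_fun (angle_dom q) (sqr_angle q).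
Proof.
apply: (@measurableT_comp _ _ _ _ _ _ (fun t : R => t ^+ 2)) => //.
apply: (@measurable_comp _ _ _ _ _ _ (`[-1, 1] : set mR)) => //.
- by move=> _ [y By <-]; rewrite /= in_itv.
- exact: measurable_acos_itv.
- by apply: measurable_funTS; exact: measurable_dotmul.
Qed.

Lemma measurable_sqr_angle_pr q : S2 q ->
  measurable_fun setT (fun x => sqr_angle q (pr x)).
Proof.
move=> Sq; apply: (measurable_comp (measurable_angle_dom q)).
- by move=> _ [x _ <-]; exact: dotmul_pr_itv.
- exact: measurable_sqr_angle.
- exact: measurable_pr.
Qed.

(** Both sides are the expectation of the squared angle between [q] and [pr X],
    computed with the density of [pr X] on the sphere and with the density of [X]
    in R^3. *)
Lemma frechet_fun_normal d (T : measurableType d) (P : probability T R)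
    (X : {RV P >-> 'rV[R]_3}) mu (sigma : R) (p : 'rV[R]_3 -> R) q :
  0 < sigma -> is_normal3 X mu (sigma ^+ 2)%:M ->
  is_density (P := P) (@pr R 3 \o X) p -> S2 q ->
  frechet_fun p q = (\int[lebesgue_measure3]_x
    (sqr_angle q (pr x) * mvnormal_pdf3 mu (sigma ^+ 2)%:M x)%:E)%E.
Proof.
move=> s0 [_ _ XE] [mp p0 YE] Sq.
pose G : 'rV[R]_3 -> \bar R := (EFin \o sqr_angle q) \_ (angle_dom q).
pose p' : 'rV[R]_3 -> \bar R := (EFin \o p) \_ S2.
have mG : measurable_fun setT G.
  apply/(measurable_restrictT _ _).1; first exact: measurable_angle_dom.
  by apply/measurable_EFinP; exact: measurable_sqr_angle.
have G0 y : (0 <= G y)%E.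
  by rewrite /G patchE; case: ifPn => // _; rewrite lee_fin sqr_ge0.
have mp' : measurable_fun setT p'.
  apply/(measurable_restrictT _ _).1; first exact: measurable_S2.
  exact/measurable_EFinP.
have p'0 y : (0 <= p' y)%E.
  by rewrite /p' patchE; case: ifPn => // /set_mem Sy; rewrite lee_fin p0.
have p'fin y : p' y \is a fin_num by rewrite /p' patchE; case: ifPn.
have YE' A : measurable A ->
    (distribution P (@pr R 3 \o X) A = \int[dVol]_(y in A) p' y)%E.
  by move=> mA; rewrite YE// integral_mkcondr.
transitivity (\int[distribution P (@pr R 3 \o X)]_y G y)%E.
  rewrite (ge0_integral_density mp' p'0 p'fin YE' mG G0).
  rewrite /frechet_fun [LHS]integral_mkcond;apply: eq_integral => y _.
  rewrite /G /p' !patchE; case: (boolP (y \in S2)) => [/set_mem Sy|_];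
    last by rewrite mule0.
  by rewrite mem_set ?geodistE ?EFinM//; exact: S2_dotmul_itv.
pose phi x := (mvnormal_pdf3 mu (sigma ^+ 2)%:M x)%:E.
have mphi : measurable_fun setT phi.
  by apply/measurable_EFinP; exact: measurable_mvnormal_pdf3_isotropic.
have phi0 x : (0 <= phi x)%E by rewrite lee_fin ltW// mvnormal_pdf3_gt0.
pose H x : \bar R := (sqr_angle q (pr x))%:E.
have mH : measurable_fun setT H by apply/measurable_EFinP; exact: measurable_sqr_angle_pr.
have H0 x : (0 <= H x)%E by rewrite lee_fin sqr_ge0.
transitivity (\int[distribution P X]_x H x)%E; last first.
  transitivity (\int[lebesgue_measure3]_x (H x * phi x))%E.
    exact: (ge0_integral_density mphi phi0 _ XE mH H0).
  by apply: eq_integral => x _; rewrite /H /phi EFinM.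
have -> : (\int[distribution P (@pr R 3 \o X)]_y G y = \int[P]_t G (pr (X t)))%E.
  exact: (ge0_integral_pushforward _ P measurableT mG (fun y _ => G0 y)).
have -> : (\int[distribution P X]_x H x = \int[P]_t H (X t))%E.
  exact: (ge0_integral_pushforward _ P measurableT mH (fun y _ => H0 y)).
apply: eq_integral => t _; rewrite /G /H patchE mem_set//.
exact: dotmul_pr_itv.
Qed.

End angle.

(** * Comparison by reflection *)

Section reflection_theory.
Context {R : realType} {n : nat}.
Implicit Types (w x y : 'rV[R]_n).

Lemma reflectionZ w c x : reflection w (c *: x) = c *: reflection w x.
Proof.
by rewrite /reflection dotmulZr scalerBr scalerA; congr (_ - _ *: _); ring.
Qed.

Lemma dotmul_reflection w x y :
  dotmul (reflection w x) y = dotmul x (reflection w y).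
Proof.
rewrite /reflection dotmulDl dotmulDr dotmulNl dotmulNr dotmulZl dotmulZr.
by rewrite [dotmul x w]dotmulC; congr (_ - _); ring.
Qed.

Lemma reflectionK w : w != 0 -> involutive (reflection w).
Proof.
rewrite -dotmul_eq0 => ww x; rewrite /reflection dotmulDr dotmulNr dotmulZr.
rewrite -addrA -opprD -scalerDl [X in X *: _](_ : _ = 0) ?scale0r ?subr0//.
by field.
Qed.

Lemma dotmul_reflection2 w x y : w != 0 ->
  dotmul (reflection w x) (reflection w y) = dotmul x y.
Proof. by move=> w0; rewrite dotmul_reflection reflectionK. Qed.

Lemma pr_reflection w x : w != 0 -> pr (reflection w x) = reflection w (pr x).
Proof. by move=> w0; rewrite /pr /enorm dotmul_reflection2// reflectionZ. Qed.

End reflection_theory.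

Section minimization.
Context (R : realType).
Local Notation mR := (measurableTypeR R).
Local Notation leb := (@lebesgue_measure R).
Local Notation leb3 := (@lebesgue_measure3 R).
Implicit Types (m q x w : 'rV[R]_3).

Lemma dotmul_S2_sub m q : S2 m -> S2 q ->
  2 * dotmul (m - q) m = dotmul (m - q) (m - q).
Proof.
move=> /S2_dotmul mm /S2_dotmul qq.
rewrite !(dotmulDl, dotmulDr, dotmulNl, dotmulNr) mm qq.
by rewrite [dotmul q m]dotmulC; ring.
Qed.

Lemma reflection_swap m q : S2 m -> S2 q -> m != q ->
  reflection (m - q) m = q.
Proof.
move=> Sm Sq mq; rewrite /reflection dotmul_S2_sub// mulfV.
  by rewrite scale1r opprB addrC subrK.
by rewrite dotmul_eq0 subr_eq0.
Qed.

Lemma leb3_cube : leb3 [set x | forall i, 0 < x ord0 i < 1] = 1%E.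
Proof.
rewrite /lebesgue_measure3 /pushforward.
rewrite [X in (_ \x _)%E X](_ : _ = (`]0, 1[ `*` `]0, 1[) `*` `]0, 1[); last first.
  apply/seteqP; split => -[[x y] z] /=; rewrite !in_itv/=.
    by move=> h; have := h 0; have := h 1; have := h 2; rewrite !mxE.
  by move=> [[x01 y01] z01] i; have [->|->|->] := ord3P i; rewrite !mxE.
pose J : set R := `]0, 1[%classic.
have mJ : measurable (J : set mR) by exact: measurable_itv.
transitivity ((leb \x leb) (J `*` J) * leb J)%E.
  exact: (@product_measure1E _ _ (mR * mR)%type mR R (leb \x leb)%E leb _ _
    (measurableX mJ mJ) mJ).
rewrite [X in (X * _)%E](_ : _ = leb J * leb J)%E; last first.
  exact: (@product_measure1E _ _ mR mR R leb leb _ _ mJ mJ).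
by rewrite lebesgue_measure_itv/= lte_fin ltr01 -EFinB subr0 !mule1.
Qed.

Lemma measurable_not_orthogonal w : measurable [set x | dotmul w x != 0].
Proof.
rewrite (_ : [set _ | _] = setT `&` dotmul w @^-1` (~` [set 0])).
  by apply: measurable_dotmul => //; exact: measurableC.
by rewrite setTI; apply/seteqP; split=> x /= /eqP.
Qed.

(** A transvection maps this set onto the set where some coordinate is nonzero,
    which contains the unit cube. *)
Lemma leb3_not_orthogonal w : w != 0 -> leb3 [set x | dotmul w x != 0] != 0%E.
Proof.
move=> w0; have [k wk0] := row_neq0_coord w0.
pose e : 'rV[R]_3 := delta_mx 0 k.
have wkE : 1 + (w - e) ord0 k = w ord0 k by rewrite !mxE !eqxx/=; ring.
have wk1 : 1 + (w - e) ord0 k != 0 by rewrite wkE.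
have [_] := volume_factor_transvect wk1.
move=> /(_ (fun x => (\1_[set x | dotmul e x != 0] x)%:E)) vf; apply/eqP => N0.
have : leb3 [set x | dotmul e x != 0] = 0%E.
  transitivity (\int[leb3]_x (\1_[set x | dotmul e x != 0] x)%:E)%E.
    by rewrite integral_indic ?setIT//; exact: measurable_not_orthogonal.
  rewrite vf; last 2 first.
  - by apply/measurable_EFinP; apply: measurable_indic; exact: measurable_not_orthogonal.
  - by move=> x; rewrite lee_fin.
  rewrite [X in (_ * X)%E](_ : _ = 0%E) ?mule0//.
  transitivity (\int[leb3]_x (\1_[set x | dotmul w x != 0] x)%:E)%E; last first.
    by rewrite integral_indic ?setIT//; exact: measurable_not_orthogonal.
  apply: eq_integral => x _; rewrite !indicE; congr ((nat_of_bool _)%:R%:E).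
  have eU : dotmul e (transvect k (w - e) x) = dotmul w x.
    rewrite dotmulDr dotmulZr dotmul_delta [e ord0 k]mxE !eqxx mulr1.
    by rewrite dotmulDl dotmulNl addrC subrK.
  by apply/idP/idP; rewrite !inE /= eU.
apply/eqP; rewrite gt_eqF//.
apply: (@lt_le_trans _ _ (leb3 [set x | forall i, 0 < x ord0 i < 1])).
  by rewrite leb3_cube lte01.
apply: le_measure; rewrite ?inE.
- rewrite (_ : [set _ | _] = \bigcap_(i in [set: 'I_3]) [set x | 0 < x ord0 i < 1]).
    apply: fin_bigcap_measurable => [|i _]; first exact: finite_finset.
    rewrite [X in measurable X](_ : _ =
        setT `&` (fun x : 'rV[R]_3 => x ord0 i) @^-1` `]0, 1[).
      by apply: measurable_coord => //; exact: measurable_itv.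
    by rewrite setTI; apply/seteqP; split => x /=; rewrite in_itv.
  by apply/seteqP; split => x /= h i; [move=> _|]; exact: h.
- exact: measurable_not_orthogonal.
- by move=> x /= /(_ k) /andP[xk _]; rewrite dotmul_deltal gt_eqF.
Qed.

(** With a the squared angle to [m] and r the reflection exchanging [m] and [q],
    the squared angle to [q] is a \o r.  As r is involutive and preserves volume,
    twice the difference of the two integrals is the integral of
    D = (a \o r - a) (phi - phi \o r), whose factors both have the sign of
    <m - q, x>. *)
Lemma sqr_angle_integral_lt m q (phi : 'rV[R]_3 -> R) :
  S2 m -> S2 q -> m != q ->
  measurable_fun setT phi -> (forall x, 0 <= phi x) ->
  (\int[leb3]_x (phi x)%:E < +oo)%E ->
  (forall x, 0 < dotmul (m - q) x -> phi (reflection (m - q) x) < phi x) ->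
  (\int[leb3]_x (sqr_angle m (pr x) * phi x)%:E <
   \int[leb3]_x (sqr_angle q (pr x) * phi x)%:E)%E.
Proof.
move=> Sm Sq mq mphi phi0 phioo phi_lt.
set w := m - q in phi_lt; have w0 : w != 0 by rewrite subr_eq0.
pose r := reflection w; pose a x := sqr_angle m (pr x).
have aE x : sqr_angle q (pr x) = a (r x).
  rewrite /a /r pr_reflection// /sqr_angle -dotmul_reflection.
  by rewrite reflection_swap.
under [ltRHS]eq_integral do rewrite aE.
have [mr vr] := volume_factor_reflection w0.
have rK : involutive r by exact: reflectionK.
have ma : measurable_fun setT a by exact: measurable_sqr_angle_pr.
have mar : measurable_fun setT (a \o r) by exact: measurableT_comp.
have mpr : measurable_fun setT (phi \o r) by exact: measurableT_comp.
have a0 x : 0 <= a x by exact: sqr_ge0.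
pose I (f g : 'rV[R]_3 -> R) := (\int[leb3]_x (f x * g x)%:E)%E.
have Ir (f g : 'rV[R]_3 -> R) : measurable_fun setT f -> measurable_fun setT g ->
    (forall x, 0 <= f x) -> (forall x, 0 <= g x) ->
    I f g = I (f \o r) (g \o r).
  move=> mf mg f0 g0; rewrite /I vr ?mul1e//.
  - by apply/measurable_EFinP; exact: measurable_funM.
  - by move=> x; rewrite lee_fin mulr_ge0.
pose D x := (a (r x) - a x) * (phi x - phi (r x)).
have Dpos x : 0 < dotmul w x -> 0 < D x.
  move=> wx; have x0 : x != 0.
    by apply: contraTneq wx => ->; rewrite dotmul0r ltxx.
  rewrite mulr_gt0 ?subr_gt0 ?phi_lt// -aE /a /sqr_angle.
  have hm := dotmul_pr_itv x Sm; have hq := dotmul_pr_itv x Sq.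
  rewrite ltr_sqr ?nnegrE ?acos_ge0// acos_lt ?in_itv//=.
  rewrite -subr_gt0 -dotmulNl -dotmulDl -/w dotmulZr mulr_gt0//.
  by rewrite invr_gt0 enorm_gt0.
have wr x : dotmul w (r x) = - dotmul w x.
  have ww0 : dotmul w w != 0 by rewrite dotmul_eq0.
  by rewrite /r /reflection dotmulDr dotmulNr dotmulZr; field.
have Dneq x : dotmul w x != 0 -> 0 < D x.
  rewrite neq_lt => /orP[wx|]; last exact: Dpos.
  have := Dpos (r x); rewrite wr oppr_gt0 => /(_ wx); rewrite /D rK.
  by congr (_ < _); ring.
have D0 x : 0 <= D x.
  have [wx|/Dneq/ltW//] := eqVneq (dotmul w x) 0.
  by rewrite /D /r /reflection wx mulr0 mul0r scale0r subr0 !subrr mulr0.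
have mD : measurable_fun setT D.
  by apply: measurable_funM; apply: measurable_funB.
have ID : (0 < \int[leb3]_x (D x)%:E)%E.
  rewrite lt_def; apply/andP; split; last first.
    by apply: integral_ge0 => x _; rewrite lee_fin.
  have mDE : measurable_fun setT (EFin \o D) by exact/measurable_EFinP.
  apply/eqP => /(ge0_integral_eq0 mDE) /= h.
  have /negP := leb3_not_orthogonal w0; apply; apply/eqP/measure_negligible.
    exact: measurable_not_orthogonal.
  apply: negligibleS (h _) => [x /= wx|x]; last by rewrite lee_fin.
  by rewrite eqe gt_eqF ?Dneq.
have I2 (f g : 'rV[R]_3 -> R) : measurable_fun setT f -> measurable_fun setT g ->
    (forall x, 0 <= f x) -> (forall x, 0 <= g x) ->
    (\int[leb3]_x (f x)%:E + \int[leb3]_x (g x)%:E =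
     \int[leb3]_x (f x + g x)%:E)%E.
  move=> mf mg f0 g0; under [RHS]eq_integral do rewrite EFinD.
  by rewrite ge0_integralD//; try (exact/measurable_EFinP); move=> x _; rewrite lee_fin.
have sum : (I a phi + I a phi + \int[leb3]_x (D x)%:E =
    I (a \o r) phi + I (a \o r) phi)%E.
  have -> : (I a phi + I a phi = I a phi + I (a \o r) (phi \o r))%E.
    by congr (_ + _)%E; exact: Ir.
  have -> : (I (a \o r) phi + I (a \o r) phi =
      I (a \o r) phi + I ((a \o r) \o r) (phi \o r))%E.
    by congr (_ + _)%E; apply: Ir => // x; exact: a0.
  have mM (f g : 'rV[R]_3 -> R) : measurable_fun setT f -> measurable_fun setT g ->
      measurable_fun setT (fun x => f x * g x) by exact: measurable_funM.
  have marr : measurable_fun setT ((a \o r) \o r) by exact: measurableT_comp.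
  have ge0 x y z : 0 <= a x * phi y + a z * phi (r y).
    by apply: addr_ge0; apply: mulr_ge0.
  rewrite /I !I2//; try exact: mM;
    try (by move=> x; apply: mulr_ge0; [exact: a0|exact: phi0]).
  - by apply: eq_integral => x _; rewrite /D /= rK; congr EFin; ring.
  - by apply: measurable_funD; exact: mM.
  - by move=> x; exact: ge0.
have Ioo : I a phi \is a fin_num.
  rewrite ge0_fin_numE; last by apply: integral_ge0 => x _; rewrite lee_fin mulr_ge0.
  apply: (@le_lt_trans _ _ (\int[leb3]_x ((pi ^+ 2)%:E * (phi x)%:E))%E).
    apply: ge0_le_integral => //.
    - by move=> x _; rewrite lee_fin mulr_ge0.
    - by apply/measurable_EFinP; exact: measurable_funM.
    - by apply/measurable_EFinP; exact: measurable_funM.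
    - by move=> x _; rewrite lee_fin ler_wpM2r// sqr_angle_pr_le.
  rewrite ge0_integralZl_EFin ?sqr_ge0//.
  - by rewrite lte_mul_pinfty// ?lee_fin ?sqr_ge0.
  - by move=> x _; rewrite lee_fin.
  - exact/measurable_EFinP.
rewrite -/(I a phi) -/(I (a \o r) phi) ltNge; apply/negP => le.
have Ioo2 : (I a phi + I a phi)%E \is a fin_num by rewrite fin_numD Ioo.
have := leeD le le; apply/negP; rewrite -ltNge.
by move: ID; rewrite -(lteDl _ Ioo2) sum.
Qed.

End minimization.

(** * The intrinsic mean *)

(** |r x - mu|^2 - |x - mu|^2 = 2 <x - r x, mu>, and x - r x is a positive
    multiple of w = pr mu - q, while <w, pr mu> = |w|^2 / 2 because [pr mu] and
    [q] are unit vectors. *)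
Lemma mvnormal_pdf3_reflection_lt (R : realType) (mu q x : 'rV[R]_3) (sigma : R) :
  0 < sigma -> mu != 0 -> S2 q -> 0 < dotmul (pr mu - q) x ->
  mvnormal_pdf3 mu (sigma ^+ 2)%:M (reflection (pr mu - q) x) <
  mvnormal_pdf3 mu (sigma ^+ 2)%:M x.
Proof.
move=> s0 mu0 Sq; set w := pr mu - q => wx.
have w0 : w != 0.
  by apply: contraTneq wx => ->; rewrite dotmul0l ltxx.
have ww0 : dotmul w w != 0 by rewrite dotmul_eq0.
have mu_gt0 : 0 < enorm mu by rewrite enorm_gt0.
have wmu : 2 * dotmul w mu = enorm mu * dotmul w w.
  have := dotmul_S2_sub (S2_pr mu0) Sq; rewrite -/w => <-.
  have -> : dotmul w mu = enorm mu * dotmul w (pr mu).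
    by rewrite -dotmulZr scalerA mulfV ?scale1r// gt_eqF.
  by ring.
apply: mvnormal_pdf3_lt => //; rewrite -subr_gt0.
have -> : dotmul (reflection w x - mu) (reflection w x - mu) -
    dotmul (x - mu) (x - mu) = 2 * (dotmul x mu - dotmul (reflection w x) mu).
  have dE y : dotmul (y - mu) (y - mu) =
      dotmul y y - 2 * dotmul y mu + dotmul mu mu.
    rewrite !(dotmulDl, dotmulDr, dotmulNl, dotmulNr).
    by rewrite [dotmul mu y]dotmulC; ring.
  by rewrite !dE dotmul_reflection2//; ring.
rewrite /reflection dotmulDl dotmulNl dotmulZl opprB addrC subrK.
rewrite (_ : 2 * _ = 2 * dotmul w x * enorm mu); first by rewrite !mulr_gt0.
rewrite (_ : dotmul w mu = enorm mu * dotmul w w / 2); first by field.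
by rewrite -wmu; field.
Qed.

Theorem theorem2p6 (R : realType) (d : measure_display) (T : measurableType d)
    (P : probability T R) (X : {RV P >-> 'rV[R]_3})
    (mu : 'rV[R]_3) (Sigma : 'M[R]_3) (sigma : R)
    (hmu : mu != 0) (hX : is_normal3 X mu Sigma)
    (hsigma : 0 < sigma) (hSigma : Sigma = (sigma ^+ 2)%:M) :
  is_intrinsic_mean (P := P) (@pr R 3 \o X) (pr mu).
Proof.
rewrite {Sigma}hSigma in hX; split; first exact: normal_pr_is_density hX.
move=> p hp; have Sm := S2_pr hmu.
have F_lt q : S2 q -> pr mu != q -> (frechet_fun p (pr mu) < frechet_fun p q)%E.
  move=> Sq mq; rewrite !(frechet_fun_normal hsigma hX hp)//.
  apply: sqr_angle_integral_lt => //.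
  - exact: measurable_mvnormal_pdf3_isotropic.
  - by move=> x; rewrite ltW// mvnormal_pdf3_gt0.
  - have [_ _ XE] := hX.
    by rewrite -XE//= probability_setT ltry.
  - by move=> x; exact: mvnormal_pdf3_reflection_lt.
apply/seteqP; split=> [q [Sq q_min]|_ -> /=].
  apply/eqP; rewrite eq_sym; apply/negP => /negP mq.
  by have := q_min _ Sm; rewrite leNgt F_lt.
by split=> // q Sq; have [<-//|mq] := eqVneq (pr mu) q; rewrite ltW// F_lt.
Qed.
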